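(* Let $0<\alpha<n$. There is a constant $c_{n,\alpha}$ depending only on $n$ and $\alpha$ such that for every $f\in L^p(\mathbb{R}^n)$ with $1\le p\le2$, and $x\in\mathbb{R}^n$: a) $\displaystyle \big|(-\Delta)^{-\alpha/2}f(x)\big|\le c_{n,\alpha}\Big(\lambda^{n-\alpha}M\hat f(0)+\lambda^{-\alpha}Mf(x)\Big)$ for any $\lambda>0$; b) $\displaystyle \big|(-\Delta)^{-\alpha/2}f(x)\big|\le c_{n,\alpha}\big(M\hat f(0)\big)^{\alpha/n}\big(Mf(x)\big)^{1-\alpha/n}$.
   Context: $M$ is the Hardy–Littlewood maximal function, $Mf(x)=\sup_{r>0}\frac1{|B(x,r)|}\int_{B(x,r)}|f(y)|\,dy$ for locally integrable $f$. The Fourier transform is $\hat f(\xi)=\int_{\mathbb{R}^n}e^{-ix\cdot\xi}f(x)\,dx$ (extended to $L^p$, $1\le p\le2$, by Hausdorff–Young). $(-\Delta)^{-\alpha/2}$ is the fractional integral with Fourier multiplier $|\xi|^{-\alpha}$, understood through the Littlewood–Paley decomposition $(-\Delta)^{-\alpha/2}f(x)=(2\pi)^{-n}\sum_{j\in\mathbb{Z}}\int\psi(\xi/2^j)\frac{e^{ix\cdot\xi}}{|\xi|^\alpha}\hat f(\xi)\,d\xi$, where $\psi$ is smooth, supported in $\frac12<|\xi|<2$, with $\sum_j\psi(\xi/2^j)=1$ for $\xi\ne0$. The right-hand sides may be infinite, in which case the inequality is vacuous. *)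

(* Defs.v *)
From HB Require Import structures.
From mathcomp Require Import all_boot all_order all_algebra.
From mathcomp Require Import complex.
From mathcomp Require Import all_classical all_reals all_analysis.

Set Implicit Arguments.
Unset Strict Implicit.
Unset Printing Implicit Defensive.

Import Order.TTheory GRing.Theory Num.Theory.
Import numFieldNormedType.Exports.

Local Open Scope classical_set_scope.
Local Open Scope ring_scope.
Local Open Scope complex_scope.

Local Notation normc := ComplexField.Normc.normc.

(* The sigma-algebra on R^n = 'rV[R]_n generated by the coordinates, i.e. the
   Borel sets. *)
Section measurable_rV.
Context {R : realType} (n : nat).

Definition coord_rV (i : 'I_n) (v : 'rV[R]_n) : measurableTypeR R := v 0 i.

Let rV_set0 : g_sigma_preimage coord_rV set0.
Proof. exact: sigma_algebra0. Qed.

Let rV_setC A : g_sigma_preimage coord_rV A -> g_sigma_preimage coord_rV (~` A).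
Proof. exact: sigma_algebraC. Qed.

Let rV_bigcup (F : (set 'rV[R]_n)^nat) :
  (forall i, g_sigma_preimage coord_rV (F i)) ->
  g_sigma_preimage coord_rV (\bigcup_i (F i)).
Proof. exact: sigma_algebra_bigcup. Qed.

HB.instance Definition _ := @isMeasurable.Build default_measure_display
  'rV[R]_n (g_sigma_preimage coord_rV) rV_set0 rV_setC rV_bigcup.

Lemma measurable_coord_rV (i : 'I_n) : measurable_fun setT (coord_rV i).
Proof.
move=> _ Y mY; rewrite setTI; apply: sub_sigma_algebra => /=.
rewrite -bigcup_seq/=; exists i => /=; first by rewrite mem_index_enum.
by exists Y => //; rewrite setTI.
Qed.

Lemma measurable_fun_rVP d (T : measurableType d) (f : T -> 'rV[R]_n) :
  (forall i, measurable_fun setT (coord_rV i \o f)) -> measurable_fun setT f.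
Proof.
move=> mf.
suff prefS : g_sigma_preimage (fun i => coord_rV i \o f) `<=` measurable.
  move=> _ A mA; apply: prefS.
  by rewrite g_sigma_preimage_comp; exists A.
apply: smallest_sub; first exact: sigma_algebra_measurable.
apply: (big_ind (fun X : set (set T) => X `<=` measurable)) => //.
  by move=> X Y sX sY A [/sX|/sY].
by move=> i _ A [B mB <-]; exact: mf.
Qed.

End measurable_rV.

(* Lebesgue measure on R^(n+1) is the image of the product of the Lebesgue
   measures on R and on R^n under (a, v) |-> a :: v. *)
Section cons_rV.
Context {R : realType} (n : nat).

Definition cons_rV (p : measurableTypeR R * 'rV[R]_n) : 'rV[R]_n.+1 :=
  \row_(i < n.+1) oapp (p.2 0) p.1 (unlift ord0 i).

Definition uncons_rV (v : 'rV[R]_n.+1) : measurableTypeR R * 'rV[R]_n :=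
  (v 0 ord0, \row_(i < n) v 0 (lift ord0 i)).

Lemma uncons_rVK : cancel uncons_rV cons_rV.
Proof.
move=> v; apply/rowP => i; rewrite !mxE/=.
by case: unliftP => [j ->|->]/=; rewrite ?mxE.
Qed.

Lemma cons_rVK : cancel cons_rV uncons_rV.
Proof.
move=> [a v]; rewrite /uncons_rV !mxE unlift_none/=; congr pair.
by apply/rowP => i; rewrite !mxE liftK.
Qed.

Lemma measurable_cons_rV : measurable_fun setT cons_rV.
Proof.
apply: measurable_fun_rVP => i.
have [j ->|->] := unliftP ord0 i.
- have -> : coord_rV (lift ord0 j) \o cons_rV = coord_rV j \o snd.
    by apply/funext => p; rewrite /coord_rV/= mxE liftK.
  exact: measurableT_comp (measurable_coord_rV j) measurable_snd.
- have -> : coord_rV ord0 \o cons_rV = fst.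
    by apply/funext => p; rewrite /coord_rV/= mxE unlift_none.
  exact: measurable_fst.
Qed.

Lemma measurable_uncons_rV : measurable_fun setT uncons_rV.
Proof.
apply/measurable_fun_pairP; split; first exact: measurable_coord_rV.
apply: measurable_fun_rVP => i.
have -> : coord_rV i \o (snd \o uncons_rV) = coord_rV (lift ord0 i).
  by apply/funext => v; rewrite /coord_rV/= mxE.
exact: measurable_coord_rV.
Qed.

Variable mu : {sigma_finite_measure set 'rV[R]_n -> \bar R}.

Definition lebesgue_consm : set 'rV[R]_n.+1 -> \bar R :=
  pushforward (@lebesgue_measure R \x mu)%E cons_rV.

Let lebesgue_consm0 : lebesgue_consm set0 = 0%E.
Proof. by rewrite /lebesgue_consm /pushforward preimage_set0 measure0. Qed.

Let lebesgue_consm_ge0 A : (0 <= lebesgue_consm A)%E.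
Proof. exact: (measure_ge0 (@lebesgue_measure R \x mu)%E). Qed.

Let lebesgue_consm_sigma_additive : semi_sigma_additive lebesgue_consm.
Proof.
exact: (@measure_semi_sigma_additive _ _ _
  (measure_function_pushforward__canonical__measure_function_Measure
    (lebesgue_measure \x mu)%E measurable_cons_rV)).
Qed.

HB.instance Definition _ := isMeasure.Build _ _ _ lebesgue_consm
  lebesgue_consm0 lebesgue_consm_ge0 lebesgue_consm_sigma_additive.

Let lebesgue_consm_sigma_finite : sigma_finite setT lebesgue_consm.
Proof.
have /sigma_finiteP[F [TF ndF Foo]] := sigma_finiteT (@lebesgue_measure R).
have /sigma_finiteP[G [TG ndG Goo]] := sigma_finiteT mu.
exists (fun k => uncons_rV @^-1` (F k `*` G k)).
  rewrite -preimage_bigcup (_ : \bigcup_k _ = setT) ?preimage_setT//.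
  rewrite -setXTT TF TG predeqE => -[x y]; split.
    by move=> [n0 _ []/= ? ?]; split; exists n0.
  move=> [/= [n0 _ Fnx] [k _ Gky]]; exists (maxn n0 k) => //; split.
  - by move: x Fnx; exact/subsetPset/ndF/leq_maxl.
  - by move: y Gky; exact/subsetPset/ndG/leq_maxr.
move=> k; have [mF Fk] := Foo k; have [mG Gk] := Goo k; split.
  rewrite -[X in measurable X]setTI; apply: measurable_uncons_rV => //.
  exact: measurableX.
rewrite /lebesgue_consm /pushforward -comp_preimage.
rewrite (_ : uncons_rV \o cons_rV = id); last first.
  by apply/funext => p /=; rewrite cons_rVK.
by rewrite preimage_id product_measure1E// lte_mul_pinfty// ge0_fin_numE.
Qed.

HB.instance Definition _ := Measure_isSigmaFinite.Build _ _ _ lebesgue_consm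
  lebesgue_consm_sigma_finite.

End cons_rV.

Fixpoint lebesgue_rV (R : realType) (n : nat) :
    {sigma_finite_measure set 'rV[R]_n -> \bar R} :=
  match n with
  | 0 => \d_(0 : 'rV[R]_0)
  | m.+1 => lebesgue_consm (lebesgue_rV R m)
  end.

Lemma lebesgue_rV_box (R : realType) (n : nat)
    (A : 'I_n -> set (measurableTypeR R)) :
  (forall i, measurable (A i)) ->
  lebesgue_rV R n [set v | forall i, A i (v 0 i)]
  = (\prod_(i < n) lebesgue_measure (A i))%E.
Proof.
elim: n A => [|n IH] A mA /=.
  by rewrite big_ord0 diracE mem_set// => -[].
rewrite big_ord_recl -IH//.
have mB : measurable [set v : 'rV[R]_n | forall i, A (lift ord0 i) (v 0 i)].
  rewrite (_ : mkset _ = \bigcap_(i in [set: 'I_n])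
    (coord_rV i @^-1` A (lift ord0 i))).
    apply: fin_bigcap_measurable => // i _.
    by rewrite -[X in measurable X]setTI; exact: measurable_coord_rV.
  by apply/seteqP; split => v /= h i; [move=> _; exact: h|exact: h].
rewrite -product_measure1E//.
rewrite /lebesgue_consm /pushforward; congr product_measure1.
apply/seteqP; split => -[a v] /= h.
- split; first by have := h ord0; rewrite mxE unlift_none.
  by move=> i; have := h (lift ord0 i); rewrite mxE liftK.
- move=> i; rewrite mxE; case: h => ha hv.
  by have [j ->|->] := unliftP ord0 i; [exact: hv|].
Qed.

Section euclidean.
Context {R : realType} {n : nat}.
Implicit Types (x y : 'rV[R]_n).

Definition dotp x y : R := \sum_(i < n) x 0 i * y 0 i.

(* The norm `|x| of 'rV[R]_n is the sup norm, hence this definition. *)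
Definition enorm x : R := Num.sqrt (dotp x x).

Definition eball x (r : R) : set 'rV[R]_n := [set y | enorm (y - x) < r].

Definition iter_partial (s : seq 'I_n) (f : 'rV[R]_n -> R) : 'rV[R]_n -> R :=
  foldr (fun i g => 'D_(delta_mx 0 i) g) f s.

Definition smooth (f : 'rV[R]_n -> R) : Prop :=
  forall s, continuous (iter_partial s f) /\
    forall i x, derivable (iter_partial s f) x (delta_mx 0 i).

End euclidean.

Section fourier.
Context {R : realType} {n : nat}.
Local Notation mu := (lebesgue_rV R n).
Implicit Types (f g : 'rV[R]_n -> R[i]) (x xi : 'rV[R]_n) (p : \bar R).

Definition expi (t : R) : R[i] := cos t +i* sin t.

Definition cintegral f : R[i] :=
  (\int[mu]_x complex.Re (f x)) +i* (\int[mu]_x complex.Im (f x)).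

Definition cmeasurable f : Prop :=
  measurable_fun setT (fun x => complex.Re (f x)) /\
  measurable_fun setT (fun x => complex.Im (f x)).

Definition cLnorm p f : \bar R := 'N[mu]_p[(fun x => (normc (f x))%:E)]%E.

Definition in_Lp p f : Prop := cmeasurable f /\ (cLnorm p f < +oo)%E.

Definition fourier_L1 f xi : R[i] := cintegral (fun x => expi (- dotp x xi) * f x).

(* By the Hausdorff-Young inequality, f |-> fourier_L1 f extends uniquely from
   L^1 /\ L^p to a continuous map L^p -> L^p', for 1 <= p <= 2 and p' the
   conjugate exponent; fourier_Lp p f g says that g represents the image of f
   (g is determined up to a null set). *)
Definition fourier_Lp p f g : Prop :=
  in_Lp (hoelder_conjugate p) g /\
  exists F : nat -> 'rV[R]_n -> R[i],
    [/\ forall k, in_Lp 1 (F k) /\ in_Lp p (F k),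
        cLnorm p (fun x => F k x - f x) @[k --> \oo] --> 0%E &
        cLnorm (hoelder_conjugate p) (fun xi => fourier_L1 (F k) xi - g xi)
          @[k --> \oo] --> 0%E].

Definition HL_maximal_rV f x : \bar R :=
  ereal_sup [set ((mu (eball x r))^-1 *
                  \int[mu]_(y in eball x r) (normc (f y))%:E)%E
            | r in `]0, +oo[].

Definition littlewood_paley (psi : 'rV[R]_n -> R) : Prop :=
  [/\ smooth psi,
      forall xi, psi xi != 0 -> 2^-1 < enorm xi < 2 &
      forall xi, xi != 0 -> \sum_(j \in [set: int]) psi ((2 ^ j)^-1 *: xi) = 1].

(* The j-th summand in the Littlewood-Paley decomposition of the fractional
   integral, at x, of a function with Fourier transform fhat. *)
Definition frac_int_piece (psi : 'rV[R]_n -> R) (alpha : R) fhat x (j : int) :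
    R[i] :=
  ((2 * pi) ^- n)%:C *
  cintegral (fun xi => (psi ((2 ^ j)^-1 *: xi) / enorm xi `^ alpha)%:C *
                       expi (dotp x xi) * fhat xi).

(* s is the sum over all j in Z of a j: the series over j >= 0 and over j < 0
   both converge. *)
Definition is_sumZ (a : int -> R[i]) (s : R[i]) : Prop :=
  exists s1 s2 : (R[i] : numFieldType),
    [/\ series (fun k : nat => a k%:Z) @ \oo --> s1,
        series (fun k : nat => a (- k.+1%:Z)) @ \oo --> s2 & s = s1 + s2].

Definition is_frac_int (psi : 'rV[R]_n -> R) (alpha : R) fhat x (s : R[i]) :
    Prop :=
  is_sumZ (frac_int_piece psi alpha fhat x) s.

End fourier.

(* Main.v *)
Require Import Defs.
From mathcomp Require Import all_boot all_order all_algebra.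
From mathcomp Require Import complex.
From mathcomp Require Import all_classical all_reals all_analysis.
From mathcomp Require Import measurable_realfun ess_sup_inf.
From mathcomp Require Import ring lra zify.

(* Write F for the Fourier transform of f. The j-th Littlewood-Paley piece
   integrates F against a weight of size 2^(-j alpha) living on the ball of
   radius 2^(j+1), so it is O(2^(j(n-alpha)) MF(0)). By the multiplication
   formula it is also the integral of f against the Fourier transform of that
   weight, which is O(2^(j(n-alpha)) (1 + 2^j |y - x|)^-(n+1)), so it is
   O(2^(-j alpha) Mf(x)). The decay of the kernel comes from finite
   differences: translating the weight by h multiplies its transform by a
   character, equal to -1 for a suitable h. Splitting the sum at 2^j ~ lambda
   gives a), and balancing the two terms gives b).

   The pieces of a given psi are bounded with constants depending on psi. To get
   a uniform constant, fix one psi0 (if there is none the statement is empty):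
   the sums for psi and psi0 coincide, because psi_j is the sum of the products
   psi_j psi0_k with |j - k| <= 1, and symmetrically. *)

Import Order.TTheory GRing.Theory Num.Theory.
Import numFieldNormedType.Exports.

Local Open Scope classical_set_scope.
Local Open Scope ring_scope.

Set Implicit Arguments.
Unset Strict Implicit.
Unset Printing Implicit Defensive.

Local Notation nC := ComplexField.Normc.normc.
Local Notation cRe := complex.Re.
Local Notation cIm := complex.Im.

(** * Lebesgue measure on row vectors *)

(** The weight enters only through its size, its support and its bounded pure derivatives along each
    coordinate axis; the mean value theorem turns these into bounds on finite differences, so there
    is no integration by parts and no mixed derivative. The order n+1 is the first integer above n:
    on the ball of radius 2^k/s it beats the volume growth 2^(kn) and leaves a summable 2^-k.

    For p > 1 the function F is known only as a limit in the conjugate space, so the multiplication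
    formula needs a weight in L^p with transform in the conjugate space. Both are bounded and
    integrable, hence in every L^q with q >= 1.

    The two bounds on a piece are geometric in j, one for j -> +oo since alpha > 0, the other for j
    -> -oo since n - alpha > 0. They therefore also give the convergence of the two-sided series,
    which is part of the claim. Exchanging psi and psi0 reindexes such series by -1, 0 or 1, hence
    the lemmas on shifts.

    In b) the balancing value of lambda exists only if both maximal functions are positive and
    finite; a vanishing one is treated apart. *)

Lemma measurable_coord (R : realType) (n : nat) (i : 'I_n) :
  measurable_fun setT (fun v : 'rV[R]_n => v 0 i : R).
Proof. exact: measurable_coord_rV. Qed.

Lemma measurable_box (R : realType) (n : nat) (A : 'I_n -> set R) :
  (forall i, measurable (A i)) ->
  measurable [set v : 'rV[R]_n | forall i, A i (v 0 i)].
Proof.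
move=> mA; rewrite (_ : mkset _ = \bigcap_(i in [set: 'I_n])
  ((fun v : 'rV[R]_n => v 0 i) @^-1` A i)).
  apply: fin_bigcap_measurable => // i _.
  by rewrite -[X in measurable X]setTI; exact: measurable_coord.
by apply/seteqP; split => v /= h i; [move=> _; exact: h|exact: h].
Qed.

(* Every point of an open set lies in a cell of a grid of mesh 1/(k+1)
   contained in that set. *)
Lemma open_measurable_rV (R : realType) (n : nat) (A : set 'rV[R]_n) :
  open A -> measurable A.
Proof.
move=> oA.
pose Q (kz : nat * 'rV[int]_n) : set 'rV[R]_n :=
  [set v | forall i, `[(kz.2 0 i)%:~R / kz.1.+1%:R,
                       (kz.2 0 i + 1)%:~R / kz.1.+1%:R[%classic (v 0 i)].
pose F kz := if `[< Q kz `<=` A >] then Q kz else set0.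
have -> : A = \bigcup_kz F kz.
  apply/seteqP; split=> [x Ax|x [kz _]]; last first.
    by rewrite /F; case: asboolP => [h /h//|_ []].
  have [e /= e0 xeA] : nbhs_ball x A.
    by apply/nbhs_ballP; exact: open_nbhs_nbhs.
  have [k _ ke] := near_infty_natSinv_lt (PosNum e0).
  have {}ke : k.+1%:R^-1 < e by exact: (ke k (leqnn k)).
  have k0 : (0 : R) < k.+1%:R by rewrite ltr0n.
  have Qx : Q (k, \row_i Num.floor (x 0 i * k.+1%:R)) x.
    move=> i /=; rewrite mxE in_itv/= ler_pdivrMr// ltr_pdivlMr//.
    by rewrite Num.Theory.floor_le floorD1_gt.
  exists (k, \row_i Num.floor (x 0 i * k.+1%:R)) => //.
  rewrite /F; case: asboolP => //; apply.
  move=> v Qv; apply: xeA; split=> // i j.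
  rewrite (ord1 i) /ball/=.
  have /= := Qv j; have /= := Qx j; rewrite !in_itv/= !mxE intrD !mulrDl mulr1z div1r.
  move=> /andP[a1 a2] /andP[a3 a4].
  move: ke a1 a2 a3 a4; move: (_^-1) (_ / _) => d w ke a1 a2 a3 a4.
  by apply: lt_trans ke; rewrite /= ltr_norml; apply/andP; split; lra.
apply: countable_bigcupT_measurable => [|kz]; first exact: countableP.
rewrite /F.
case: asboolP => // _.
by apply: (measurable_box (A := fun i => `[_, _[%classic)) => i;
   exact: measurable_itv.
Qed.

Lemma continuous_measurable_rV (R : realType) (n : nat) (f : 'rV[R]_n -> R) :
  continuous f -> measurable_fun setT f.
Proof.
move=> /continuousP cf; apply: (measurability _ (@RGenOpens.measurableE R)).
move=> _ [_ [a [b ->]] <-]; rewrite setTI.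
by apply: open_measurable_rV; apply: cf; exact: interval_open.
Qed.

Lemma measurable_dotp d (T : measurableType d) (R : realType) (n : nat)
    (f g : T -> 'rV[R]_n) :
  measurable_fun setT f -> measurable_fun setT g ->
  measurable_fun setT (fun t => dotp (f t) (g t)).
Proof.
move=> mf mg; rewrite /dotp; apply: measurable_sum => i.
by apply: measurable_funM; exact: measurableT_comp (measurable_coord i) _.
Qed.

Lemma measurable_addrV d (T : measurableType d) (R : realType) (n : nat)
    (f g : T -> 'rV[R]_n) :
  measurable_fun setT f -> measurable_fun setT g ->
  measurable_fun setT (fun t => f t + g t).
Proof.
move=> mf mg; apply: measurable_fun_rVP => i.
rewrite (_ : _ \o _ = fun t => (f t 0 i : R) + g t 0 i); last first.
  by apply/funext => t /=; rewrite /coord_rV mxE.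
by apply: measurable_funD; exact: measurableT_comp (measurable_coord i) _.
Qed.

Lemma measurable_scalerV d (T : measurableType d) (R : realType) (n : nat)
    (f : T -> 'rV[R]_n) (c : R) :
  measurable_fun setT f -> measurable_fun setT (fun t => c *: f t).
Proof.
move=> mf; apply: measurable_fun_rVP => i.
rewrite (_ : _ \o _ = fun t => c * (f t 0 i : R)); last first.
  by apply/funext => t /=; rewrite /coord_rV mxE.
apply: measurable_funM => //.
exact: measurableT_comp (measurable_coord i) _.
Qed.

Lemma measurable_enorm (R : realType) (n : nat) :
  measurable_fun setT (@enorm R n).
Proof.
apply: (@measurableT_comp _ _ _ _ _ _ (@Num.sqrt R)).
  by apply: continuous_measurable_fun; exact: sqrt_continuous.
exact: measurable_dotp.
Qed.

Lemma measurable_eball (R : realType) (n : nat) (x : 'rV[R]_n) (r : R) :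
  measurable (eball x r).
Proof.
have mf : measurable_fun setT (fun y : 'rV[R]_n => enorm (y - x)).
  apply: measurableT_comp; first exact: measurable_enorm.
  exact: measurable_addrV.
rewrite (_ : eball x r = setT `&` (fun y => enorm (y - x)) @^-1` `]-oo, r[).
  exact: mf.
by rewrite setTI; apply/seteqP; split => y; rewrite /eball /= in_itv.
Qed.

Lemma coord_le_enorm (R : realType) (n : nat) (x : 'rV[R]_n) (i : 'I_n) :
  `|x 0 i| <= enorm x.
Proof.
rewrite -sqrtr_sqr ler_wsqrtr// /dotp (bigD1 i)//= expr2 lerDl.
by apply: sumr_ge0 => j _; rewrite -expr2 sqr_ge0.
Qed.

Lemma enorm_ge0 (R : realType) (n : nat) (x : 'rV[R]_n) : 0 <= enorm x.
Proof. exact: sqrtr_ge0. Qed.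

Lemma enorm_le (R : realType) (n : nat) (x : 'rV[R]_n) (m : R) :
  (forall i, `|x 0 i| <= m) -> enorm x <= n%:R * m.
Proof.
case: n x => [|n] x xm.
  by rewrite /enorm /dotp big_ord0 sqrtr0 mul0r.
have m0 : 0 <= m by exact: le_trans (xm ord0).
rewrite -[leRHS]ger0_norm ?mulr_ge0// -sqrtr_sqr ler_wsqrtr// /dotp exprMn.
apply: (@le_trans _ _ (\sum_(i < n.+1) m ^+ 2)).
  apply: ler_sum => i _; rewrite -expr2 -[leLHS]ger0_norm ?sqr_ge0//.
  by rewrite normrX lerXn2r ?nnegrE.
rewrite sumr_const card_ord -[leLHS]mulr_natl ler_wpM2r ?sqr_ge0//.
by rewrite expr2 -natrM ler_nat leq_pmulr.
Qed.

(** A Euclidean ball lies in the cube of side [2 * r] around its centre. An upper bound is enough: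
    the volume is only needed to pass from averages over balls to integrals over balls. *)
Lemma lebesgue_eball_le (R : realType) (n : nat) (x : 'rV[R]_n) (r : R) :
  0 <= r -> (lebesgue_rV R n (eball x r) <= ((2 * r) ^+ n)%:E)%E.
Proof.
move=> r0.
pose A (i : 'I_n) : set R := `]x 0 i - r, x 0 i + r[%classic.
apply: (@le_trans _ _ (lebesgue_rV R n [set v | forall i, A i (v 0 i)])).
  apply: le_measure; rewrite ?inE.
  - exact: measurable_eball.
  - by apply: measurable_box => i; exact: measurable_itv.
  - move=> y; rewrite /eball/= => yr i; rewrite /A/= in_itv/=.
    have := le_lt_trans (coord_le_enorm (y - x) i) yr.
    by rewrite !mxE ltr_norml => /andP[? ?]; apply/andP; split; lra.
rewrite lebesgue_rV_box; last by move=> i; exact: measurable_itv.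
rewrite (eq_bigr (fun=> (2 * r)%:E)) => [|i _].
  by rewrite prodEFin big_const_ord iter_mulr_1.
rewrite lebesgue_measure_itv/= lte_fin.
case: ifPn => [_|]; first by rewrite -EFinD; congr EFin; lra.
(* An empty interval forces [r = 0], so that both sides are 0. *)
by rewrite -leNgt => h; congr EFin; lra.
Qed.

Lemma lebesgue_measureD (R : realType) (a : R) (A : set R) :
  measurable A ->
  lebesgue_measure ((fun x => x + a) @^-1` A) = lebesgue_measure A :> \bar R.
Proof.
pose t (x : measurableTypeR R) : measurableTypeR R := x + a.
have mD : measurable_fun setT t by exact: measurable_funD.
pose m := measure_function_pushforward__canonical__measure_function_Measure
  (@lebesgue_measure R) mD.
move=> mA; rewrite -[LHS]/(m A); apply/esym.
refine (lebesgue_measure_unique (mu := m) _ mA) => _ [[b c] /= _ <-].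
rewrite /pushforward (_ : _ @^-1` _ = `]b - a, c - a]%classic); last first.
  by apply/seteqP; split => x; rewrite /t/= !in_itv/= => /andP[? ?];
    apply/andP; split; lra.
rewrite !lebesgue_measure_itv/= !lte_fin ltrD2r.
by case: ifP => // _; rewrite -!EFinD; congr EFin; lra.
Qed.

Lemma measurable_translate (R : realType) (n : nat) (v : 'rV[R]_n) :
  measurable_fun setT (fun x : 'rV[R]_n => x + v).
Proof. exact: measurable_addrV. Qed.

(** Induction on the dimension: a translation acts separately on the first coordinate and on the
    tail, so the translated product measure has the same values on rectangles, and a product measure
    is determined by those. *)
Lemma lebesgue_rVD (R : realType) (n : nat) (v : 'rV[R]_n)
    (A : set 'rV[R]_n) : measurable A ->
  lebesgue_rV R n ((fun x => x + v) @^-1` A) = lebesgue_rV R n A.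
Proof.
elim: n v A => [|n IH] v A mA.
  rewrite (_ : _ @^-1` A = A)//; apply/seteqP; split => x /=;
  by rewrite (_ : x + v = x)//; apply/rowP => -[].
pose t (p : measurableTypeR R * 'rV[R]_n) : measurableTypeR R * 'rV[R]_n :=
  (p.1 + v 0 ord0, p.2 + (uncons_rV v).2).
have mt : measurable_fun setT t.
  apply/measurable_fun_pairP; split.
    apply: (@measurable_funD _ _ _ setT fst (cst (v 0 ord0))) => //.
  exact: measurable_addrV.
pose m' := measure_function_pushforward__canonical__measure_function_Measure
  (@lebesgue_measure R \x lebesgue_rV R n)%E mt.
rewrite /= /lebesgue_consm /pushforward.
set B := (@cons_rV R n) @^-1` A.
have mB : measurable B.
  by rewrite -[B]setTI; apply: measurable_cons_rV.
transitivity (m' B).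
  rewrite /m'/= /pushforward; congr product_measure1.
  have tE p : cons_rV p + v = cons_rV (t p).
    apply/rowP => i; rewrite !mxE; case: unliftP => [j ->|->]/=;
    by rewrite ?mxE.
  by apply/seteqP; split => p; rewrite /B/= tE.
apply/esym.
apply: (@product_measure_unique _ _ _ _ _ (@lebesgue_measure R) (lebesgue_rV R n) m') => //.
move=> C D mC mD; rewrite /m'/= /pushforward.
rewrite (_ : t @^-1` _ = ((fun x => x + v 0 ord0) @^-1` C) `*`
   ((fun x => x + (uncons_rV v).2) @^-1` D)) //.
rewrite product_measure1E.
- by rewrite IH//; congr (_ * _)%E; exact: (lebesgue_measureD _ mC).
- rewrite -[X in measurable X]setTI.
  apply: (@measurable_funD _ _ _ setT id (cst (v 0 ord0))) => //.
- rewrite -[X in measurable X]setTI; exact: measurable_translate.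
Qed.

(** * Complex-valued integrals *)

Lemma normcE (R : realType) (z : R[i]) :
  nC z = Num.sqrt (cRe z ^+ 2 + cIm z ^+ 2).
Proof. by case: z. Qed.

Lemma normc_ge0 (R : realType) (z : R[i]) : 0 <= nC z.
Proof. by rewrite normcE sqrtr_ge0. Qed.

Lemma Re_le_normc (R : realType) (z : R[i]) : `|cRe z| <= nC z.
Proof. by rewrite normcE -sqrtr_sqr ler_wsqrtr// lerDl sqr_ge0. Qed.

Lemma Im_le_normc (R : realType) (z : R[i]) : `|cIm z| <= nC z.
Proof. by rewrite normcE -sqrtr_sqr ler_wsqrtr// lerDr sqr_ge0. Qed.

Lemma normc_le_ReIm (R : realType) (z : R[i]) : nC z <= `|cRe z| + `|cIm z|.
Proof.
rewrite normcE -[leRHS]ger0_norm ?addr_ge0// -sqrtr_sqr ler_wsqrtr//.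
by rewrite sqrrD !real_normK ?num_real// lerD2r lerDl mulrn_wge0// mulr_ge0.
Qed.

Lemma normc_real (R : realType) (a : R) : nC (a%:C)%C = `|a|.
Proof. by rewrite normcE/= expr0n/= addr0 sqrtr_sqr. Qed.

Lemma normc_expi (R : realType) (t : R) : nC (expi t) = 1.
Proof. by rewrite normcE/= cos2Dsin2 sqrtr1. Qed.

Lemma expiD (R : realType) (a b : R) : expi (a + b) = expi a * expi b.
Proof.
rewrite /expi cosD sinD; apply/eqP; rewrite eq_complex/= eqxx/=.
by apply/eqP; rewrite addrC.
Qed.

Lemma expipi (R : realType) : expi (@pi R) = -1.
Proof. by rewrite /expi cospi sinpi; apply/eqP; rewrite eq_complex/= oppr0 !eqxx. Qed.

Lemma ReM (R : realType) (a b : R[i]) :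
  cRe (a * b) = cRe a * cRe b - cIm a * cIm b.
Proof. by case: a b => [? ?] []. Qed.

Lemma ImM (R : realType) (a b : R[i]) :
  cIm (a * b) = cRe a * cIm b + cIm a * cRe b.
Proof. by case: a b => [? ?] []. Qed.

Lemma ReD (R : realType) (a b : R[i]) : cRe (a + b) = cRe a + cRe b.
Proof. by case: a b => [? ?] []. Qed.

Lemma ImD (R : realType) (a b : R[i]) : cIm (a + b) = cIm a + cIm b.
Proof. by case: a b => [? ?] []. Qed.

Lemma ReN (R : realType) (a : R[i]) : cRe (- a) = - cRe a.
Proof. by case: a. Qed.

Lemma ImN (R : realType) (a : R[i]) : cIm (- a) = - cIm a.
Proof. by case: a. Qed.

Lemma complex_ext (R : realType) (a b : R[i]) :
  cRe a = cRe b -> cIm a = cIm b -> a = b.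
Proof. by case: a b => [? ?] [? ?]/= -> ->. Qed.

Definition cmfun d (T : measurableType d) (R : realType) (f : T -> R[i]) :=
  measurable_fun setT (fun x => cRe (f x)) /\
  measurable_fun setT (fun x => cIm (f x)).

Lemma cmfunM d (T : measurableType d) (R : realType) (f g : T -> R[i]) :
  cmfun f -> cmfun g -> cmfun (fun x => f x * g x).
Proof.
move=> [f1 f2] [g1 g2]; split.
  under eq_fun do rewrite ReM.
  by apply: measurable_funB; apply: measurable_funM.
under eq_fun do rewrite ImM.
by apply: measurable_funD; apply: measurable_funM.
Qed.

Lemma cmfunD d (T : measurableType d) (R : realType) (f g : T -> R[i]) :
  cmfun f -> cmfun g -> cmfun (fun x => f x + g x).
Proof.
move=> [f1 f2] [g1 g2]; split.
  by under eq_fun do rewrite ReD; apply: measurable_funD.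
by under eq_fun do rewrite ImD; apply: measurable_funD.
Qed.

Lemma cmfunB d (T : measurableType d) (R : realType) (f g : T -> R[i]) :
  cmfun f -> cmfun g -> cmfun (fun x => f x - g x).
Proof.
move=> [f1 f2] [g1 g2]; split.
  by under eq_fun do rewrite ReD ReN; apply: measurable_funB.
by under eq_fun do rewrite ImD ImN; apply: measurable_funB.
Qed.

Lemma cmfun_real d (T : measurableType d) (R : realType) (f : T -> R) :
  measurable_fun setT f -> cmfun (fun x => (f x)%:C%C).
Proof. by move=> mf; split => //=; exact: measurable_cst. Qed.

Lemma cmfun_expi d (T : measurableType d) (R : realType) (f : T -> R) :
  measurable_fun setT f -> cmfun (fun x => expi (f x)).
Proof.
move=> mf; split => /=; apply: measurableT_comp => //;
  apply: continuous_measurable_fun; [exact: continuous_cos|exact: continuous_sin].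
Qed.

Lemma cmfun_comp d d' (T : measurableType d) (U : measurableType d')
    (R : realType) (f : U -> R[i]) (h : T -> U) :
  cmfun f -> measurable_fun setT h -> cmfun (fun x => f (h x)).
Proof.
by move=> [f1 f2] mh; split;
  [apply: (measurableT_comp f1)|apply: (measurableT_comp f2)].
Qed.

Lemma measurable_normc d (T : measurableType d) (R : realType) (f : T -> R[i]) :
  cmfun f -> measurable_fun setT (fun x => nC (f x)).
Proof.
move=> [f1 f2]; under eq_fun do rewrite normcE.
apply: (@measurableT_comp _ _ _ _ _ _ (@Num.sqrt R)).
  by apply: continuous_measurable_fun; exact: sqrt_continuous.
by apply: measurable_funD; apply: measurable_funX.
Qed.

Lemma measurable_enormc d (T : measurableType d) (R : realType) (f : T -> R[i]) :
  cmfun f -> measurable_fun setT (fun x => (nC (f x))%:E).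
Proof. by move=> mf; apply/measurable_EFinP; exact: measurable_normc. Qed.

Definition cintegrable (R : realType) (n : nat) (f : 'rV[R]_n -> R[i]) : Prop :=
  cmfun f /\ (\int[lebesgue_rV R n]_x (nC (f x))%:E < +oo)%E.

Section cintegral_theory.
Context {R : realType} {n : nat}.
Local Notation V := 'rV[R]_n.
Local Notation mu := (lebesgue_rV R n).
Implicit Types f g : V -> R[i].

Lemma cintegrable_le f (h : V -> R) :
  cmfun f -> measurable_fun setT h -> (forall x, nC (f x) <= h x) ->
  (\int[mu]_x (h x)%:E < +oo)%E -> cintegrable f.
Proof.
move=> mf mh fh hoo; split => //; apply: le_lt_trans hoo.
apply: ge0_le_integral => //=.
- by move=> x _; rewrite lee_fin normc_ge0.
- exact: measurable_enormc.
- exact/measurable_EFinP.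
- by move=> x _; rewrite lee_fin.
Qed.

Lemma cintegrable_Re f : cintegrable f ->
  mu.-integrable setT (EFin \o (fun x => cRe (f x))).
Proof.
move=> [mf foo]; apply/integrableP; split; first by
  apply/measurable_EFinP; exact: mf.1.
apply: le_lt_trans foo; apply: ge0_le_integral => //=.
- by apply/measurable_EFinP; apply: measurableT_comp => //; exact: mf.1.
- exact: measurable_enormc.
- by move=> x _; rewrite lee_fin Re_le_normc.
Qed.

Lemma cintegrable_Im f : cintegrable f ->
  mu.-integrable setT (EFin \o (fun x => cIm (f x))).
Proof.
move=> [mf foo]; apply/integrableP; split; first by
  apply/measurable_EFinP; exact: mf.2.
apply: le_lt_trans foo; apply: ge0_le_integral => //=.
- by apply/measurable_EFinP; apply: measurableT_comp => //; exact: mf.2.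
- exact: measurable_enormc.
- by move=> x _; rewrite lee_fin Im_le_normc.
Qed.

Lemma cintegralD f g : cintegrable f -> cintegrable g ->
  cintegral (fun x => f x + g x) = cintegral f + cintegral g.
Proof.
move=> fi gi; rewrite /cintegral; apply: complex_ext => /=.
  under eq_Rintegral do rewrite ReD.
  by rewrite RintegralD//; exact: cintegrable_Re.
under eq_Rintegral do rewrite ImD.
by rewrite RintegralD//; exact: cintegrable_Im.
Qed.

Lemma cintegralB f g : cintegrable f -> cintegrable g ->
  cintegral (fun x => f x - g x) = cintegral f - cintegral g.
Proof.
move=> fi gi; rewrite /cintegral; apply: complex_ext => /=.
  under eq_Rintegral do rewrite ReD ReN.
  by rewrite RintegralB//; exact: cintegrable_Re.
under eq_Rintegral do rewrite ImD ImN.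
by rewrite RintegralB//; exact: cintegrable_Im.
Qed.

Lemma cintegralZ (c : R[i]) f : cintegrable f ->
  cintegral (fun x => c * f x) = c * cintegral f.
Proof.
move=> fi; have fr := cintegrable_Re fi; have fm := cintegrable_Im fi.
have Zi (r : R) (h : V -> R) : mu.-integrable setT (EFin \o h) ->
    mu.-integrable setT (EFin \o (fun x => r * h x)).
  by move=> hi; have := integrableZl measurableT r hi.
rewrite /cintegral; apply: complex_ext => /=.
  under eq_Rintegral do rewrite ReM.
  rewrite RintegralB//; [|exact: Zi|exact: Zi].
  by rewrite !RintegralZl// ReM.
under eq_Rintegral do rewrite ImM.
rewrite RintegralD//; [|exact: Zi|exact: Zi].
by rewrite !RintegralZl// ImM.
Qed.

(** This includes the case where the integral of [h] is infinite: [fine] then turns it into 0. *)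
Lemma normr_Rintegral_le (h : V -> R) (k : V -> R) :
  measurable_fun setT h -> measurable_fun setT k ->
  (forall x, `|h x| <= k x) ->
  (`| \int[mu]_x h x |%:E <= \int[mu]_x (k x)%:E)%E.
Proof.
move=> mh mk hk.
have hh : (\int[mu]_x `|(h x)%:E| <= \int[mu]_x (k x)%:E)%E.
  apply: ge0_le_integral => //=.
  - by apply/measurable_EFinP; exact: measurableT_comp.
  - exact/measurable_EFinP.
  - by move=> x _; rewrite lee_fin hk.
apply: le_trans hh.
apply: (@le_trans _ _ `|\int[mu]_x (h x)%:E|%E).
  rewrite /Rintegral; case: (\int[mu]_x (h x)%:E)%E => [r//||]/=;
  by rewrite normr0 leey.
by apply: le_abse_integral => //; exact/measurable_EFinP.
Qed.

(** Real and imaginary parts are bounded separately, which costs the factor 2 (a rotation of the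
    phase would give 1). Later constants absorb it. *)
Lemma normc_cintegral_le f : cmfun f ->
  ((nC (cintegral f))%:E <= 2%:E * \int[mu]_x (nC (f x))%:E)%E.
Proof.
move=> mf; have mn := measurable_normc mf.
apply: (@le_trans _ _ (`|cRe (cintegral f)|%:E + `|cIm (cintegral f)|%:E)%E).
  by rewrite -EFinD lee_fin normc_le_ReIm.
rewrite (_ : 2 = 1 + 1 :> R)// EFinD ge0_muleDl// !mul1e.
by apply: leeD; apply: normr_Rintegral_le => //;
  [exact: mf.1|move=> x; exact: Re_le_normc|exact: mf.2|
   move=> x; exact: Im_le_normc].
Qed.

Lemma normc_cintegral_le_bound f (h : V -> R) :
  cmfun f -> measurable_fun setT h -> (forall x, nC (f x) <= h x) ->
  ((nC (cintegral f))%:E <= 2%:E * \int[mu]_x (h x)%:E)%E.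
Proof.
move=> mf mh fh; apply: (le_trans (normc_cintegral_le mf)).
rewrite lee_pmul2l//; apply: ge0_le_integral => //=.
- by move=> x _; rewrite lee_fin normc_ge0.
- exact: measurable_enormc.
- exact/measurable_EFinP.
- by move=> x _; rewrite lee_fin.
Qed.

Lemma eq_cintegral f g : f =1 g -> cintegral f = cintegral g.
Proof. by move=> /funext ->. Qed.

Lemma Rintegral_shift (h : V -> R) (v : V) : measurable_fun setT h ->
  mu.-integrable setT (EFin \o h) ->
  \int[mu]_x h (x + v) = \int[mu]_x h x.
Proof.
move=> mh hi; rewrite /Rintegral; congr fine.
pose t (x : V) := x + v.
have mt : measurable_fun setT t by exact: measurable_translate.
have hi' : (pushforward mu t).-integrable setT (EFin \o h).
  apply/integrableP; split; first exact/measurable_EFinP.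
  move/integrableP : hi => [_]; apply: le_lt_trans.
  rewrite le_eqVlt; apply/orP; left; apply/eqP.
  by apply: eq_measure_integral => A mA _; exact: lebesgue_rVD.
transitivity (\int[pushforward mu t]_x (h x)%:E)%E.
  rewrite (@integral_pushforward _ _ _ _ _ _ mt)//.
    exact/measurable_EFinP.
  rewrite preimage_setT; apply/integrableP; split.
    by apply/measurable_EFinP; exact: measurableT_comp.
  move/integrableP : hi' => [_]; apply: le_lt_trans.
  rewrite (@ge0_integral_pushforward _ _ _ _ _ _ mt)//.
  by apply: measurableT_comp => //; exact/measurable_EFinP.
by apply: eq_measure_integral => A mA _; exact: lebesgue_rVD.
Qed.

Lemma cintegral_shift f (v : V) : cintegrable f ->
  cintegral (fun x => f (x + v)) = cintegral f.
Proof.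
move=> fi; rewrite /cintegral; congr Complex.
  exact: (@Rintegral_shift (fun x => cRe (f x)) v fi.1.1 (cintegrable_Re fi)).
exact: (@Rintegral_shift (fun x => cIm (f x)) v fi.1.2 (cintegrable_Im fi)).
Qed.

(** The extended integral is the difference of the Tonelli integrals of the positive and negative
    parts, hence measurable in [y] even where it is infinite. *)
Lemma measurable_Rintegral2 (h : V * V -> R) : measurable_fun setT h ->
  measurable_fun setT (fun y => \int[mu]_x h (x, y)).
Proof.
move=> mh; rewrite /Rintegral; apply: measurableT_comp => //.
have mE : measurable_fun setT (EFin \o h) by exact/measurable_EFinP.
rewrite (_ : (fun _ => _) = fun y =>
   (\int[mu]_x ((EFin \o h)^\+ (x, y)) - \int[mu]_x ((EFin \o h)^\- (x, y)))%E).
  apply: emeasurable_funB.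
    apply: (@measurable_fun_fubini_tonelli_G _ _ V V R mu) => //.
    exact: measurable_funepos.
  apply: (@measurable_fun_fubini_tonelli_G _ _ V V R mu) => //.
  exact: measurable_funeneg.
apply/funext => y; rewrite integralE; congr (_ - _)%E; apply: eq_integral => x _.
  by rewrite !funeposE.
by rewrite !funenegE.
Qed.

(** The inner integrals are real numbers produced by [fine], which can be undone only where they are
    finite; hence integrability of every section rather than of almost every one. *)
Lemma RFubini (h : V * V -> R) :
  (mu \x mu)%E.-integrable setT (EFin \o h) ->
  (forall x, mu.-integrable setT (fun y => (h (x, y))%:E)) ->
  (forall y, mu.-integrable setT (fun x => (h (x, y))%:E)) ->
  \int[mu]_x \int[mu]_y h (x, y) = \int[mu]_y \int[mu]_x h (x, y).
Proof.
move=> hi h1 h2; rewrite /Rintegral; congr fine.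
under eq_integral do rewrite fineK ?integrable_fin_num//.
under [RHS]eq_integral do rewrite fineK ?integrable_fin_num//.
exact: (Fubini hi).
Qed.

(** One real majorant [k] controls the real and imaginary parts together; its finite sections supply
    the integrability that [RFubini] asks for at every point. *)
Lemma cFubini (h : V -> V -> R[i]) (k : V -> V -> R) :
  cmfun (fun p : V * V => h p.1 p.2) ->
  measurable_fun setT (fun p : V * V => k p.1 p.2) ->
  (forall x y, nC (h x y) <= k x y) ->
  (forall x, \int[mu]_y (k x y)%:E < +oo)%E ->
  (forall y, \int[mu]_x (k x y)%:E < +oo)%E ->
  (\int[mu]_x \int[mu]_y (k x y)%:E < +oo)%E ->
  cintegral (fun x => cintegral (fun y => h x y)) =
  cintegral (fun y => cintegral (fun x => h x y)).
Proof.
move=> mh mk hk k1 k2 k12.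
have s1 (x : V) : measurable_fun setT (fun y : V => (x, y)).
  exact: measurable_pair1.
have s2 (y : V) : measurable_fun setT (fun x : V => (x, y)).
  exact: measurable_pair2.
have k0 x y : 0 <= k x y by apply: le_trans (hk x y); exact: normc_ge0.
have c1 x : cintegrable (h x).
  apply: (@cintegrable_le _ (k x)) => //; first exact: (cmfun_comp mh (s1 x)).
  exact: (measurableT_comp mk (s1 x)).
have c2 y : cintegrable (h ^~ y).
  apply: (@cintegrable_le _ (k ^~ y)) => //; first exact: (cmfun_comp mh (s2 y)).
  exact: (measurableT_comp mk (s2 y)).
have prod (u : V -> V -> R) : measurable_fun setT (fun p : V * V => u p.1 p.2) ->
    (forall x y, `|u x y| <= k x y) ->
    (mu \x mu)%E.-integrable setT (EFin \o (fun p => u p.1 p.2)).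
  move=> mu' uk; apply/integrable12ltyP; first exact/measurable_EFinP.
  apply: le_lt_trans k12; apply: ge0_le_integral => //=.
  - by move=> x _; exact: integral_ge0.
  - apply: (@measurable_fun_fubini_tonelli_F _ _ V V R mu
       (fun p => `|u p.1 p.2|%:E)) => //.
    by apply/measurable_EFinP; exact: measurableT_comp.
  - apply: (@measurable_fun_fubini_tonelli_F _ _ V V R mu
       (fun p => (k p.1 p.2)%:E)) => //; first exact/measurable_EFinP.
    by move=> x; rewrite lee_fin.
  - move=> x _; apply: ge0_le_integral => //=.
    + apply/measurable_EFinP; apply: measurableT_comp => //.
      exact: (measurableT_comp mu' (s1 x)).
    + by apply/measurable_EFinP; exact: (measurableT_comp mk (s1 x)).
    + by move=> y _; rewrite lee_fin.
rewrite /cintegral /=; congr Complex.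
  apply: (@RFubini (fun p => cRe (h p.1 p.2))).
  - apply: (prod (fun x y => cRe (h x y))); first exact: mh.1.
    by move=> x y; exact: le_trans (Re_le_normc _) (hk _ _).
  - by move=> x; exact: cintegrable_Re (c1 x).
  - by move=> y; exact: cintegrable_Re (c2 y).
apply: (@RFubini (fun p => cIm (h p.1 p.2))).
- apply: (prod (fun x y => cIm (h x y))); first exact: mh.2.
  by move=> x y; exact: le_trans (Im_le_normc _) (hk _ _).
- by move=> x; exact: cintegrable_Im (c1 x).
- by move=> y; exact: cintegrable_Im (c2 y).
Qed.

End cintegral_theory.

(** * The multiplication formula *)

Section lebesgue_spaces.
Context {R : realType} {n : nat}.
Local Notation V := 'rV[R]_n.
Local Notation mu := (lebesgue_rV R n).
Implicit Types f g : V -> R[i].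

Lemma cLnorm_ge0 (p : \bar R) f : (0 <= cLnorm p f)%E.
Proof. exact: Lnorm_ge0. Qed.

Lemma eq_cLnorm (p : \bar R) f g :
  (forall x, nC (f x) = nC (g x)) -> cLnorm p f = cLnorm p g.
Proof. by move=> fg; apply: eq_Lnorm => x; rewrite fg. Qed.

Lemma cLnorm1 f : cLnorm 1 f = (\int[mu]_x (nC (f x))%:E)%E.
Proof.
rewrite /cLnorm Lnorm1; apply: eq_integral => x _.
by rewrite gee0_abs// lee_fin normc_ge0.
Qed.

Lemma cHoelder (p : R) f g : 1 <= p -> cmfun f -> cmfun g ->
  (\int[mu]_x (nC (f x * g x))%:E <=
   cLnorm p%:E f * cLnorm (hoelder_conjugate p%:E) g)%E.
Proof.
move=> p1 mf mg.
have mfg := measurable_enormc (cmfunM mf mg).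
move: p1; rewrite le_eqVlt => /predU1P[<-|p1].
  rewrite hoelder_conjugate1 cLnorm1 /cLnorm unlock.
  (* For the exponent +oo the norm is an essential supremum only if the whole space has positive
     measure; otherwise it is 0 by convention, and the integrals vanish as well. *)
  case: ifPn => [mu0|]; last first.
    rewrite -leNgt => mu0.
    have mu00 : mu setT = 0%E by apply/eqP; rewrite eq_le mu0 measure_ge0.
    by rewrite null_set_integral ?mule0.
  set s := ess_sup _ _.
  have s0 : (0 <= s)%E.
    by apply: ess_sup_gee => //; apply/nearW => x; exact: abse_ge0.
  rewrite muleC -ge0_integralZl//; last 2 first.
  - exact: measurable_enormc.
  - by move=> x _; rewrite lee_fin normc_ge0.
  apply: ae_ge0_le_integral => //.
  - by move=> x _; rewrite lee_fin normc_ge0.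
  - by move=> x _; rewrite mule_ge0// lee_fin normc_ge0.
  - by apply: emeasurable_funM => //; exact: measurable_enormc.
  have : {ae mu, forall x, (`|(nC (g x))%:E| <= s)%E} by exact: ess_sup_ge.
  apply: filterS => x gs _; rewrite ComplexField.Normc.normcM EFinM muleC.
  rewrite lee_pmul// ?lee_fin ?normc_ge0//.
  by move: gs; rewrite gee0_abs// lee_fin normc_ge0.
have p0 : 0 < p by exact: lt_trans p1.
have [q [q0 pq qE]] : exists q : R, [/\ 0 < q, p^-1 + q^-1 = 1 &
    hoelder_conjugate p%:E = q%:E].
  have p10 : 0 < p - 1 by rewrite subr_gt0.
  exists (p / (p - 1)); split.
  - exact: divr_gt0.
  - by field; rewrite ?gt_eqF.
  - rewrite /hoelder_conjugate/= eqe gt_eqF// -EFinD inver gt_eqF//.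
rewrite qE.
have := @hoelder _ _ _ mu (fun x => nC (f x)) (fun x => nC (g x)) p q
  (measurable_normc mf) (measurable_normc mg) p0 q0 pq.
apply: le_trans; rewrite Lnorm1.
apply: ge0_le_integral => //=.
- by move=> x _; rewrite lee_fin normc_ge0.
- apply/measurable_EFinP; apply: measurableT_comp => //.
  by apply: measurable_funM; exact: measurable_normc.
- move=> x _; rewrite lee_fin ComplexField.Normc.normcM.
  exact: ler_norm.
Qed.

Lemma cintegrable_cHoelder (p : R) f g : 1 <= p -> cmfun f -> cmfun g ->
  (cLnorm p%:E f < +oo)%E -> (cLnorm (hoelder_conjugate p%:E) g < +oo)%E ->
  cintegrable (fun x => f x * g x).
Proof.
move=> p1 mf mg foo goo; split; first exact: cmfunM.
apply: le_lt_trans (cHoelder p1 mf mg) _.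
by rewrite lte_mul_pinfty ?ge0_fin_numE ?cLnorm_ge0.
Qed.

Lemma cmfun_fourier_L1 f : cmfun f -> cmfun (fourier_L1 f).
Proof.
move=> mf.
have mh : cmfun (fun p : V * V => expi (- dotp p.1 p.2) * f p.1).
  apply: cmfunM; last by apply: (cmfun_comp mf); exact: measurable_fst.
  apply: cmfun_expi; apply: measurableT_comp => //.
  by apply: measurable_dotp; [exact: measurable_fst|exact: measurable_snd].
by split; [exact: (measurable_Rintegral2 mh.1)|exact: (measurable_Rintegral2 mh.2)].
Qed.

Lemma normc_fourier_L1_le f xi : cmfun f ->
  ((nC (fourier_L1 f xi))%:E <= 2%:E * \int[mu]_x (nC (f x))%:E)%E.
Proof.
move=> mf; rewrite /fourier_L1.
apply: (@normc_cintegral_le_bound _ _ _ (fun x => nC (f x))).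
- apply: cmfunM => //; apply: cmfun_expi; apply: measurableT_comp => //.
  exact: measurable_dotp.
- exact: measurable_normc.
- by move=> x; rewrite ComplexField.Normc.normcM normc_expi mul1r.
Qed.

Lemma dotpC (x y : V) : dotp x y = dotp y x.
Proof. by apply: eq_bigr => i _; rewrite mulrC. Qed.

Lemma dotpBr (x y z : V) : dotp x (y - z) = dotp x y - dotp x z.
Proof. by rewrite /dotp -sumrB; apply: eq_bigr => i _; rewrite !mxE mulrBr. Qed.

Lemma dotpDl (x y z : V) : dotp (x + y) z = dotp x z + dotp y z.
Proof. by rewrite /dotp -big_split; apply: eq_bigr => i _; rewrite !mxE mulrDl. Qed.

Lemma integral_normc_ge0 f : (0 <= \int[mu]_x (nC (f x))%:E)%E.
Proof. by apply: integral_ge0 => x _; rewrite lee_fin normc_ge0. Qed.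

Lemma integral_normcZ (c : R[i]) f : cmfun f ->
  (\int[mu]_x (nC c * nC (f x))%:E = (nC c)%:E * \int[mu]_x (nC (f x))%:E)%E.
Proof.
move=> mf; under eq_integral do rewrite EFinM.
rewrite ge0_integralZl_EFin ?normc_ge0//.
- by move=> x _; rewrite lee_fin normc_ge0.
- exact: measurable_enormc.
Qed.

(** Fubini applies because [g xi * f y] is integrable on the product. The characters
    [expi (dotp x xi)] and [expi (- dotp y xi)] merge into the kernel of the transform of [g] at
    [y - x]. *)
Lemma fourier_multiplication f g x : cintegrable f -> cintegrable g ->
  cintegral (fun xi => g xi * (expi (dotp x xi) * fourier_L1 f xi)) =
  cintegral (fun y => f y * fourier_L1 g (y - x)).
Proof.
move=> fi gi; have [mf foo] := fi; have [mg goo] := gi.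
have mE (t : V) : cmfun (fun y => expi (- dotp y t)).
  by apply: cmfun_expi; apply: measurableT_comp => //; exact: measurable_dotp.
have nE (u : V -> R) h : cintegrable h -> measurable_fun setT u ->
    cintegrable (fun y => expi (u y) * h y).
  move=> [mh hoo] mu'; apply: (@cintegrable_le _ _ _ (fun y => nC (h y))) => //.
  - by apply: cmfunM => //; exact: cmfun_expi.
  - exact: measurable_normc.
  - by move=> y; rewrite ComplexField.Normc.normcM normc_expi mul1r.
transitivity (cintegral (fun xi => cintegral (fun y =>
    (g xi * expi (dotp x xi)) * (expi (- dotp y xi) * f y)))).
  apply: eq_cintegral => xi; rewrite cintegralZ ?mulrA//.
  by apply: nE => //; apply: measurableT_comp => //; exact: measurable_dotp.
rewrite (@cFubini _ _ _ (fun xi y => nC (g xi) * nC (f y))).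
- apply: eq_cintegral => y.
  rewrite /fourier_L1 -cintegralZ; last first.
    by apply: nE => //; apply: measurableT_comp => //; exact: measurable_dotp.
  apply: eq_cintegral => xi.
  by rewrite dotpBr (dotpC x) (dotpC y) opprB addrC expiD; ring.
- apply: cmfunM; apply: cmfunM.
  + by apply: (cmfun_comp mg); exact: measurable_fst.
  + apply: cmfun_expi; apply: measurable_dotp => //.
  + apply: cmfun_expi; apply: measurableT_comp => //.
    by apply: measurable_dotp.
  + by apply: (cmfun_comp mf); exact: measurable_snd.
- by apply: measurable_funM;
   [apply: (measurableT_comp (measurable_normc mg))|
    apply: (measurableT_comp (measurable_normc mf))].
- move=> xi y; rewrite !ComplexField.Normc.normcM !normc_expi mulr1 mul1r.
  exact: lexx.
- move=> xi; rewrite integral_normcZ// lte_mul_pinfty// lee_fin.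
  exact: normc_ge0.
- move=> y; under eq_integral do rewrite mulrC.
  by rewrite integral_normcZ// lte_mul_pinfty// lee_fin normc_ge0.
- under eq_integral do rewrite integral_normcZ// muleC.
  rewrite ge0_integralZl//.
  + by rewrite lte_mul_pinfty// ?ge0_fin_numE// integral_normc_ge0.
  + exact: measurable_enormc.
  + by move=> y _; rewrite lee_fin normc_ge0.
  + exact: integral_normc_ge0.
Qed.

Lemma cmfun_fourier_Lp p f fhat : fourier_Lp p f fhat -> cmfun fhat.
Proof. by move=> [[]]. Qed.

(* The multiplication formula passes to the limit along the sequence defining
   the Fourier transform on L^p, by Hoelder's inequality on both sides. *)
Lemma fourier_Lp_multiplication (p : R) f fhat g x : 1 <= p ->
  in_Lp p%:E f -> fourier_Lp p%:E f fhat -> cintegrable g ->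
  (cLnorm p%:E g < +oo)%E ->
  (cLnorm (hoelder_conjugate p%:E) (fun y => fourier_L1 g (y - x)%R) < +oo)%E ->
  cintegral (fun xi => g xi * (expi (dotp x xi) * fhat xi)) =
  cintegral (fun y => f y * fourier_L1 g (y - x)).
Proof.
move=> p1 [mf foo] [[mh hoo] [F [FL Ff Fh]]] gi gp.
set q := hoelder_conjugate p%:E; set w := fun y => fourier_L1 g (y - x) => wq.
have [mg goo] := gi.
have mw : cmfun w.
  apply: (cmfun_comp (cmfun_fourier_L1 mg)); exact: measurable_addrV.
pose ge xi := g xi * expi (dotp x xi).
have mge : cmfun ge.
  apply: cmfunM => //; apply: cmfun_expi; exact: measurable_dotp.
have gep : (cLnorm p%:E ge < +oo)%E.
  rewrite (@eq_cLnorm _ ge g)// => xi.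
  by rewrite ComplexField.Normc.normcM normc_expi mulr1.
have mF k : cmfun (F k) by have [[]] := FL k.
have F1 k : cintegrable (F k).
  by split => //; rewrite -cLnorm1; have [[]] := FL k.
have mFh k : cmfun (fourier_L1 (F k)) by exact: cmfun_fourier_L1.
set A := cintegral _; set B := cintegral _.
have AE : A = cintegral (fun xi => ge xi * fhat xi).
  by apply: eq_cintegral => xi; rewrite mulrA.
have geh : cintegrable (fun xi => ge xi * fhat xi).
  exact: (cintegrable_cHoelder p1).
have gei : cintegrable ge.
  apply: (@cintegrable_le _ _ _ (fun xi => nC (g xi))) => //.
    exact: measurable_normc.
  by move=> xi; rewrite ComplexField.Normc.normcM normc_expi mulr1.
(* As [F k] is integrable, its transform is bounded by a constant [M], while [ge] is integrable. *)
have geF k : cintegrable (fun xi => ge xi * fourier_L1 (F k) xi).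
  have Moo : (2%:E * \int[mu]_x (nC (F k x))%:E < +oo)%E.
    by rewrite lte_mul_pinfty//; exact: (F1 k).2.
  pose M : R := fine (2%:E * \int[mu]_x (nC (F k x))%:E)%E.
  have FM xi : nC (fourier_L1 (F k) xi) <= M.
    rewrite -lee_fin /M fineK; first exact: normc_fourier_L1_le.
    rewrite ge0_fin_numE// mule_ge0//; apply: integral_ge0 => y _.
    by rewrite lee_fin normc_ge0.
  apply: (@cintegrable_le _ _ _ (fun xi => M * nC (ge xi))).
  - exact: cmfunM.
  - apply: measurable_funM => //; exact: measurable_normc.
  - move=> xi; rewrite ComplexField.Normc.normcM mulrC.
    by rewrite ler_wpM2r ?normc_ge0.
  - under eq_integral do rewrite EFinM.
    rewrite ge0_integralZl_EFin//.
    + rewrite lte_mul_pinfty//; last exact: gei.2.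
      by rewrite lee_fin (le_trans _ (FM 0))// normc_ge0.
    + by move=> y _; rewrite lee_fin normc_ge0.
    + exact: measurable_enormc.
    + by rewrite (le_trans _ (FM 0))// normc_ge0.
have fw : cintegrable (fun y => f y * w y) by exact: (cintegrable_cHoelder p1).
have Fw k : cintegrable (fun y => F k y * w y).
  by apply: (cintegrable_cHoelder p1) => //; have [_ []] := FL k.
pose d1 k := cLnorm q (fun xi => fourier_L1 (F k) xi - fhat xi).
pose d2 k := cLnorm p%:E (fun y => F k y - f y).
(* [A] and [B] are compared through [F k], for which the two integrals agree by
   [fourier_multiplication]; only the two approximation errors remain, and Hoelder bounds each. *)
have key k : ((nC (A - B))%:E <= (2%:E * cLnorm p%:E ge) * d1 k +
    (2%:E * cLnorm q w) * d2 k)%E.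
  have E1 : A - B = - cintegral (fun xi => ge xi * (fourier_L1 (F k) xi - fhat xi))
      + cintegral (fun y => (F k y - f y) * w y).
    rewrite (@eq_cintegral _ _ (fun xi => ge xi * (fourier_L1 (F k) xi - fhat xi))
      (fun xi => ge xi * fourier_L1 (F k) xi - ge xi * fhat xi)); last first.
      by move=> xi; rewrite mulrBr.
    rewrite (@eq_cintegral _ _ (fun y => (F k y - f y) * w y)
      (fun y => F k y * w y - f y * w y)); last first.
      by move=> xi; rewrite mulrBl.
    rewrite (cintegralB (geF k) geh) (cintegralB (Fw k) fw) -AE.
    rewrite -[cintegral (fun y => f y * w y)]/B.
    rewrite (@eq_cintegral _ _ (fun xi => ge xi * fourier_L1 (F k) xi)
      (fun xi => g xi * (expi (dotp x xi) * fourier_L1 (F k) xi))); last first.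
      by move=> xi; rewrite mulrA.
    rewrite fourier_multiplication// -/w.
    by rewrite opprB addrA subrK.
  rewrite E1; apply: (@le_trans _ _ ((nC (cintegral (fun xi => ge xi *
      (fourier_L1 (F k) xi - fhat xi))))%:E +
      (nC (cintegral (fun y => (F k y - f y) * w y)))%:E)%E).
    by rewrite -EFinD lee_fin (le_trans (le_normcD _ _))// normcN.
  apply: leeD.
    apply: le_trans (normc_cintegral_le _) _.
      by apply: cmfunM => //; exact: cmfunB.
    rewrite -muleA lee_pmul2l//; apply: cHoelder => //.
    exact: cmfunB.
  apply: le_trans (normc_cintegral_le _) _.
    by apply: cmfunM => //; exact: cmfunB.
  rewrite -muleA lee_pmul2l// muleC; apply: cHoelder => //.
  exact: cmfunB.
have fin1 : (2%:E * cLnorm p%:E ge)%E \is a fin_num.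
  by rewrite ge0_fin_numE ?lte_mul_pinfty// mule_ge0// cLnorm_ge0.
have fin2 : (2%:E * cLnorm q w)%E \is a fin_num.
  by rewrite ge0_fin_numE ?lte_mul_pinfty// mule_ge0// cLnorm_ge0.
have lim0 : ((2%:E * cLnorm p%:E ge) * d1 k +
    (2%:E * cLnorm q w) * d2 k)%E @[k --> \oo] --> 0%E.
  rewrite -[X in _ --> X]adde0; apply: cvgeD => //.
    by rewrite -[X in _ --> X](mule0 (2%:E * cLnorm p%:E ge)%E); exact: cvgeZl.
  by rewrite -[X in _ --> X](mule0 (2%:E * cLnorm q w)%E); exact: cvgeZl.
have : ((nC (A - B))%:E <= 0)%E.
  by apply: (cvge_to_ge lim0); apply: nearW.
rewrite lee_fin => h; apply/eqP; rewrite -subr_eq0; apply/eqP.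
by apply: ComplexField.Normc.eq0_normc; apply/eqP; rewrite eq_le h normc_ge0.
Qed.

End lebesgue_spaces.

(** * Convolution with decaying kernels *)

Section maximal.
Context {R : realType} {n : nat}.
Local Notation V := 'rV[R]_n.
Local Notation mu := (lebesgue_rV R n).
Implicit Types (f w : V -> R[i]) (x : V).

Lemma HL_maximal_rV_ge0 f x : (0 <= HL_maximal_rV f x)%E.
Proof.
apply: (@le_trans _ _ ((mu (eball x 1))^-1 *
   \int[mu]_(y in eball x 1) (nC (f y))%:E)%E).
  rewrite mule_ge0 ?inve_ge0 ?measure_ge0//.
  by apply: integral_ge0 => y _; rewrite lee_fin normc_ge0.
by apply: ereal_sup_ubound; exists 1 => //=; rewrite in_itv/= ltr01.
Qed.

Lemma integral_eball_le_HL_maximal f x (r : R) : cmfun f -> 0 < r ->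
  (\int[mu]_(y in eball x r) (nC (f y))%:E <=
   ((2 * r) ^+ n)%:E * HL_maximal_rV f x)%E.
Proof.
move=> mf r0.
have mf' D : measurable_fun D (fun y : V => (nC (f y))%:E).
  by apply: measurable_funTS; exact: measurable_enormc.
have mB := lebesgue_eball_le x (ltW r0).
(* Only an upper bound on the volume is at hand, so a null ball is treated apart: there the average
   cannot be multiplied back by the volume, but the integral is 0. *)
have [m0|m0] := eqVneq (mu (eball x r)) 0%E.
  rewrite null_set_integral//; last exact: measurable_eball.
  by rewrite mule_ge0 ?HL_maximal_rV_ge0// lee_fin exprn_ge0// mulr_ge0// ltW.
have mfin : mu (eball x r) \is a fin_num.
  by rewrite ge0_fin_numE ?measure_ge0// (le_lt_trans mB)// ltry.
set I := (\int[mu]_(y in _) _)%E.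
have HI : ((mu (eball x r))^-1 * I <= HL_maximal_rV f x)%E.
  by apply: ereal_sup_ubound; exists r => //=; rewrite in_itv/= r0.
apply: (@le_trans _ _ (mu (eball x r) * HL_maximal_rV f x)%E); last first.
  by apply: lee_wpmul2r => //; exact: HL_maximal_rV_ge0.
apply: le_trans (lee_wpmul2l (measure_ge0 _ _) HI).
rewrite muleA -(fineK mfin) inver ifF; last first.
  by apply/negbTE; rewrite -eqe fineK.
by rewrite -[X in (X * _ * _)%E](fineK mfin) -EFinM divff ?mul1e// -eqe fineK.
Qed.

(* Radially decreasing step functions equivalent to
   (1 + s |y - x|)^-(n+1): integrating against one of them costs at most a
   maximal function. *)
Definition dyadic_tail (s : R) x (y : V) : \bar R :=
  (\sum_(0 <= k <oo) ((2 ^- (k * n.+1)) * \1_(eball x (2 ^+ k / s)) y)%:E)%E.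

Lemma measurable_dyadic_tail s x : measurable_fun setT (dyadic_tail s x).
Proof.
apply: ge0_emeasurable_sum => [k y _ _|k _].
  by rewrite lee_fin mulr_ge0// invr_ge0 exprn_ge0.
apply/measurable_EFinP; apply: measurable_funM => //.
by apply: measurable_indic; exact: measurable_eball.
Qed.

Lemma dyadic_tail_ge0 s x y : (0 <= dyadic_tail s x y)%E.
Proof.
by apply: nneseries_ge0 => k _ _; rewrite lee_fin mulr_ge0// invr_ge0 exprn_ge0.
Qed.

(** The maximal function bounds the integral over the ball of radius [2 ^ k / s] by a multiple of
    its volume growth [2 ^ (k n)]; the weight [2 ^ (- k (n+1))] leaves [2 ^ (- k)], which is
    summable. *)
Lemma integral_dyadic_tail_le f (s : R) x : cmfun f -> 0 < s ->
  (\int[mu]_y ((nC (f y))%:E * dyadic_tail s x y) <=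
   (2 ^+ n.+1 / s ^+ n)%:E * HL_maximal_rV f x)%E.
Proof.
move=> mf s0; have M0 := HL_maximal_rV_ge0 f x.
have [->|Moo] := eqVneq (HL_maximal_rV f x) +oo%E.
  by rewrite gt0_muley ?leey// lte_fin divr_gt0// exprn_gt0.
have /fineK Mfin : HL_maximal_rV f x \is a fin_num by rewrite ge0_fin_numE// ltey.
have mfE := measurable_enormc mf.
pose t k y : \bar R := ((nC (f y) *
  ((2 ^- (k * n.+1)) * \1_(eball x (2 ^+ k / s)) y))%:E)%E.
have c0 k : 0 <= 2 ^- (k * n.+1) :> R by rewrite invr_ge0 exprn_ge0.
have t0 k y : (0 <= t k y)%E.
  by rewrite lee_fin mulr_ge0 ?normc_ge0// mulr_ge0.
rewrite (_ : (\int[mu]_y _)%E = (\int[mu]_y (\sum_(0 <= k <oo) t k y))%E); last first.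
  by apply: eq_integral => y _; rewrite -nneseriesZl.
rewrite integral_nneseries//; last first.
  move=> k; apply/measurable_EFinP; apply: measurable_funM.
    exact: measurable_normc.
  apply: measurable_funM => //.
  by apply: measurable_indic; exact: measurable_eball.
(* [2 / 2 ^ k.+1] is [2 ^ (- k)], in the shape for which [epsilon_trick0] bounds the sum by 2. *)
apply: (@le_trans _ _ (\sum_(0 <= k <oo)
   ((2 / (2 ^ k.+1)%:R)%:E * ((2 ^+ n / s ^+ n)%:E * HL_maximal_rV f x)))%E).
  apply: lee_nneseries => [k _ _|k _]; first exact: integral_ge0.
  rewrite (_ : (\int[mu]_y t k y)%E = ((2 ^- (k * n.+1))%:E *
     \int[mu]_(y in eball x (2 ^+ k / s)) (nC (f y))%:E)%E); last first.
    rewrite -ge0_integralZl_EFin//; first last.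
    - exact: measurable_funTS.
    - by move=> y _; rewrite lee_fin normc_ge0.
    - exact: measurable_eball.
    rewrite [RHS]integral_mkcond.
    apply: eq_integral => y _; rewrite /t patchE indicE.
    by case: ifP => _; rewrite /= ?mulr1 ?mulr0 ?mule0// -EFinM mulrC.
  have r0 : 0 < 2 ^+ k / s by rewrite divr_gt0 ?exprn_gt0.
  have := integral_eball_le_HL_maximal x mf r0.
  move=> /(lee_wpmul2l (_ : 0 <= (2 ^- (k * n.+1))%:E)%E) => /(_ _)/le_trans; apply.
    by rewrite lee_fin.
  rewrite !muleA -!EFinM lee_wpmul2r// lee_fin.
  rewrite natrX !exprMn exprVn mulnS exprD -exprM exprS.
  rewrite le_eqVlt; apply/orP; left; apply/eqP.
  by field; rewrite !expf_neq0// gt_eqF.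
rewrite -Mfin -!EFinM; under eq_eseriesr do rewrite -EFinM mulrC EFinM.
rewrite nneseriesZl; last by move=> k _; rewrite lee_fin divr_ge0.
apply: (@le_trans _ _ ((2 ^+ n / s ^+ n * fine (HL_maximal_rV f x))%:E * 2%:E)%E).
  apply: lee_wpmul2l; last exact: epsilon_trick0.
  by rewrite lee_fin mulr_ge0 ?fine_ge0// divr_ge0// exprn_ge0// ltW.
by rewrite -EFinM lee_fin exprS mulrC !mulrA.
Qed.

Lemma nneseries_ge_term (u : (\bar R)^nat) (k : nat) :
  (forall i, 0 <= u i)%E -> (u k <= \sum_(0 <= i <oo) u i)%E.
Proof.
move=> u0; apply: le_trans (nneseries_lim_ge k.+1 _); last by [].
by rewrite big_nat_recr//= leeDr// sume_ge0.
Qed.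

(** A single term of the series is enough, that of the least [k] with [s |y - x| < 2 ^ k]. For
    [k = 0] the uniform bound on [w] applies; otherwise [2 ^ (k - 1) <= s |y - x|], and this shift
    by one in the exponent costs the factor [2 ^ n.+1]. *)
Lemma decay_le_dyadic_tail (w : V -> R) (A s : R) x y : 0 < s -> 0 <= A ->
  (forall z, w z <= A) ->
  (forall z, 1 <= s * enorm z -> w z <= A / (s * enorm z) ^+ n.+1) ->
  ((w (y - x))%:E <= (A * 2 ^+ n.+1)%:E * dyadic_tail s x y)%E.
Proof.
move=> s0 A0 wA wd; set rho := s * enorm (y - x).
have rho0 : 0 <= rho by rewrite mulr_ge0 ?enorm_ge0// ltW.
have ex : exists k, (rho < 2 ^+ k :> R).
  exists (Num.truncn rho).+1; apply: (lt_le_trans (truncnS_gt _)).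
  by rewrite -natrX ler_nat ltnW// ltn_expl.
case: (ex_minnP ex) => k rhok kmin.
have yB j : rho < 2 ^+ j -> eball x (2 ^+ j / s) y.
  by rewrite /eball/= ltr_pdivlMr// mulrC.
have term : ((w (y - x))%:E <= (A * 2 ^+ n.+1)%:E *
    ((2 ^- (k * n.+1)) * \1_(eball x (2 ^+ k / s)) y)%:E)%E.
  rewrite indicE mem_set ?mulr1; last exact: yB.
  rewrite -EFinM lee_fin; case: k rhok kmin => [|k] rhok kmin.
    rewrite mul0n expr0 invr1 mulr1; apply: (le_trans (wA _)).
    by rewrite ler_peMr// exprn_ege1// ler1n.
  have krho : 2 ^+ k <= rho.
    by rewrite leNgt; apply/negP => /kmin; rewrite ltnn.
  have rho1 : 1 <= rho by apply: le_trans krho; rewrite exprn_ege1// ler1n.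
  apply: (le_trans (wd _ rho1)); rewrite -mulrA ler_wpM2l//.
  rewrite mulSn exprD invfM mulrA divff ?expf_neq0// mul1r exprM.
  rewrite lef_pV2 ?posrE ?exprn_gt0//; last exact: lt_le_trans rho1.
  by rewrite lerXn2r ?nnegrE ?exprn_ge0.
apply: (le_trans term); rewrite lee_wpmul2l//.
  by rewrite lee_fin mulr_ge0// exprn_ge0.
apply: (@nneseries_ge_term (fun k => ((2 ^- (k * n.+1)) *
  \1_(eball x (2 ^+ k / s)) y)%:E)) => i.
by rewrite lee_fin mulr_ge0// invr_ge0 exprn_ge0.
Qed.

(** This is the classical domination of a convolution by the maximal function when the kernel has an
    integrable radially decreasing majorant; [A / s ^ n] is, up to a constant, the mass of that
    majorant. *)
Lemma integral_decay_le f w (A s : R) x : cmfun f -> cmfun w ->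
  0 < s -> 0 <= A -> (forall z, nC (w z) <= A) ->
  (forall z, 1 <= s * enorm z -> nC (w z) <= A / (s * enorm z) ^+ n.+1) ->
  (\int[mu]_y (nC (f y * w (y - x)%R))%:E <=
   (A * 2 ^+ n.+1 * (2 ^+ n.+1 / s ^+ n))%:E * HL_maximal_rV f x)%E.
Proof.
move=> mf mw s0 A0 wA wd.
have mwx : cmfun (fun y : V => w (y - x)).
  by apply: (cmfun_comp mw); exact: measurable_addrV.
have AA : 0 <= A * 2 ^+ n.+1 by rewrite mulr_ge0// exprn_ge0.
apply: (@le_trans _ _ (\int[mu]_y ((A * 2 ^+ n.+1)%:E *
   ((nC (f y))%:E * dyadic_tail s x y)))%E).
  apply: ge0_le_integral => //=.
  - by move=> y _; rewrite lee_fin normc_ge0.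
  - by apply: measurable_enormc; exact: cmfunM.
  - apply: emeasurable_funM => //; apply: emeasurable_funM.
      exact: measurable_enormc.
    exact: measurable_dyadic_tail.
  - move=> y _; rewrite ComplexField.Normc.normcM EFinM muleCA.
    apply: lee_wpmul2l; first by rewrite lee_fin normc_ge0.
    exact: (@decay_le_dyadic_tail (fun z => nC (w z))).
rewrite ge0_integralZl_EFin//; first last.
- apply: emeasurable_funM; first exact: measurable_enormc.
  exact: measurable_dyadic_tail.
- by move=> y _; rewrite mule_ge0 ?dyadic_tail_ge0// lee_fin normc_ge0.
rewrite [X in (_ <= X * _)%E]EFinM -muleA lee_wpmul2l//; exact: integral_dyadic_tail_le.
Qed.

(** With [f] constantly 1, [integral_decay_le] then yields the integrability of the decaying kernel
    itself, without a separate computation. *)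
Lemma HL_maximal_rV1_le x : (HL_maximal_rV (fun _ : V => 1%R) x <= 1)%E.
Proof.
apply: ub_ereal_sup => _ [r /= + <-]; rewrite in_itv/= andbT => r0.
rewrite (_ : (\int[mu]_(y in eball x r) _)%E = mu (eball x r)); last first.
  rewrite /= expr1n expr0n/= addr0 sqrtr1.
  by rewrite (integral_cst mu (measurable_eball x r) 1%E) mul1e.
have mB := lebesgue_eball_le x (ltW r0).
have [->|m0] := eqVneq (mu (eball x r)) 0%E; first by rewrite mule0.
have mfin : mu (eball x r) \is a fin_num.
  by rewrite ge0_fin_numE ?measure_ge0// (le_lt_trans mB)// ltry.
rewrite -(fineK mfin) inver ifF; last by apply/negbTE; rewrite -eqe fineK.
by rewrite -EFinM mulVf// -eqe fineK.
Qed.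

Lemma cintegrable_decay w (A s : R) x : cmfun w ->
  0 < s -> 0 <= A -> (forall z, nC (w z) <= A) ->
  (forall z, 1 <= s * enorm z -> nC (w z) <= A / (s * enorm z) ^+ n.+1) ->
  cintegrable (fun y : V => w (y - x)).
Proof.
move=> mw s0 A0 wA wd; split.
  by apply: (cmfun_comp mw); exact: measurable_addrV.
have m1 : cmfun (fun _ : V => 1 : R[i]) by split; exact: measurable_cst.
have := integral_decay_le x m1 mw s0 A0 wA wd.
under eq_integral do rewrite mul1r.
move=> /le_lt_trans; apply; rewrite lte_mul_pinfty//.
- rewrite lee_fin !mulr_ge0 ?invr_ge0 ?exprn_ge0//; exact: ltW.
- by apply: (le_lt_trans (HL_maximal_rV1_le x)); rewrite ltry.
Qed.

(** For finite [q] one has [|w| ^ q <= A ^ (q - 1) |w|], whose integral is finite. This puts both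
    the weight and its transform in the spaces required by Hoelder. *)
Lemma bounded_cLnorm_lty w (A : R) (q : \bar R) : cintegrable w ->
  (forall z, nC (w z) <= A) -> (1 <= q)%E -> (cLnorm q w < +oo)%E.
Proof.
move=> wi wA; have [mw woo] := wi; case: q => [q| |]//; last first.
  move=> _; rewrite /cLnorm unlock; case: ifPn => // mu0.
  apply: (@le_lt_trans _ _ A%:E); last exact: ltry.
  by apply/ess_supP; apply: nearW => y /=; rewrite lee_fin ger0_norm ?normc_ge0.
rewrite lee_fin => q1; rewrite /cLnorm unlock; apply: poweR_lty.
have A0 : 0 <= A by apply: le_trans (wA 0); exact: normc_ge0.
apply: (@le_lt_trans _ _ (\int[mu]_y ((A `^ (q - 1))%:E * (nC (w y))%:E))%E).
  apply: ge0_le_integral => //=.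
  - apply/measurable_EFinP; apply: (@measurableT_comp _ _ _ _ _ _ (@powR R ^~ q)).
      exact: measurable_powR.
    by apply: measurableT_comp => //; exact: measurable_normc.
  - apply: emeasurable_funM => //; exact: measurable_enormc.
  - move=> y _; rewrite -EFinM lee_fin ger0_norm ?normc_ge0//.
    have [->|w0] := eqVneq (nC (w y)) 0.
      by rewrite mulr0 powR0// gt_eqF// (lt_le_trans ltr01).
    have {1}-> : q = (q - 1) + 1 by rewrite subrK.
    rewrite powRD; last by rewrite w0 implybT.
    rewrite powRr1 ?normc_ge0// ler_wpM2r ?normc_ge0//.
    by apply: ge0_ler_powR; rewrite ?nnegrE ?normc_ge0// subr_ge0.
rewrite ge0_integralZl_EFin ?powR_ge0//.
- by rewrite lte_mul_pinfty// lee_fin powR_ge0.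
- by move=> y _; rewrite lee_fin normc_ge0.
- exact: measurable_enormc.
Qed.

End maximal.

(** * Finite differences *)

Lemma eq_is_derive_fun (R : realType) (f g : R -> R) (t d : R) :
  f =1 g -> is_derive t 1 f d -> is_derive t 1 g d.
Proof. by move=> /funext ->. Qed.

Section directional_derivatives.
Context {R : realType} {n : nat}.
Local Notation V := 'rV[R]_n.
Implicit Types (g : V -> R) (v x : V).

(** Stating the derivative along lines, at parameter 0 but for every base point, makes the
    one-variable rules and the mean value theorem directly available. *)
Definition has_dderiv v g g' :=
  forall x, is_derive (0 : R) 1 (fun s : R => g (x + s *: v)) (g' x).

Lemma has_dderivP v g g' x (t : R) : has_dderiv v g g' ->
  is_derive t 1 (fun s : R => g (x + s *: v)) (g' (x + t *: v)).
Proof.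
move=> dg; have := dg (x + t *: v) => d0.
have dt : is_derive t (1 : R) (fun s : R => s - t) 1.
  have := is_deriveB (is_derive_id t (1 : R)) (is_derive_cst t t (1 : R)).
  by rewrite subr0.
have e0 : t - t = 0 by rewrite subrr.
rewrite -e0 in d0.
have := is_derive1_comp (g := fun s : R => s - t) d0 dt.
rewrite mulr1; apply: eq_is_derive_fun => s.
by rewrite /= -addrA -scalerDl (addrC t) subrK.
Qed.

Lemma has_dderivD v f f' g g' : has_dderiv v f f' -> has_dderiv v g g' ->
  has_dderiv v (fun x => f x + g x) (fun x => f' x + g' x).
Proof. by move=> df dg x; exact: (is_deriveD (df x) (dg x)). Qed.

Lemma has_dderivM v f f' g g' : has_dderiv v f f' -> has_dderiv v g g' ->
  has_dderiv v (fun x => f x * g x) (fun x => f x * g' x + g x * f' x).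
Proof.
move=> df dg x; have := is_deriveM (df x) (dg x).
by rewrite scale0r addr0.
Qed.

Lemma has_dderivZ v (c : R) g g' : has_dderiv v g g' ->
  has_dderiv v (fun x => c * g x) (fun x => c * g' x).
Proof. by move=> dg x; exact: (is_deriveZ c (dg x)). Qed.

Lemma has_dderiv_scale v (a : R) g g' : has_dderiv v g g' ->
  has_dderiv v (fun x => g (a *: x)) (fun x => a * g' (a *: x)).
Proof.
move=> dg x.
have da : is_derive (0 : R) (1 : R) (fun s : R => a * s) a.
  by have := is_deriveZ a (is_derive_id (0 : R) (1 : R)); rewrite /GRing.scale/= mulr1.
have d0 := dg (a *: x).
rewrite -(mulr0 a) in d0.
have := is_derive1_comp (g := fun s : R => a * s) d0 da.
rewrite mulrC; apply: eq_is_derive_fun => s.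
by rewrite /= scalerDr scalerA.
Qed.

Lemma has_dderiv_shift v h g g' : has_dderiv v g g' ->
  has_dderiv v (fun x => g (x + h)) (fun x => g' (x + h)).
Proof.
move=> dg x; have := dg (x + h); apply: eq_is_derive_fun => s.
by rewrite addrAC.
Qed.

Lemma has_dderiv_le v g g' (M : R) x (t : R) : has_dderiv v g g' ->
  (forall y, `|g' y| <= M) -> `|g (x + t *: v) - g x| <= M * `|t|.
Proof.
move=> dg gM; pose phi s := g (x + s *: v).
have dphi (s : R) : is_derive s (1 : R) phi (g' (x + s *: v)) by exact: has_dderivP.
have cphi (a b : R) : {within `[a, b], continuous phi}.
  by apply: derivable_within_continuous => s _; exact: ex_derive.
have -> : g x = phi 0 by rewrite /phi scale0r addr0.
rewrite -/(phi t); have [t0|t0] := leP 0 t.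
  have [c _ ->] := MVT_segment t0 (fun s _ => dphi s) (cphi _ _).
  by rewrite subr0 normrM ler_wpM2r.
have [c _] := MVT_segment (ltW t0) (fun s _ => dphi s) (cphi _ _).
rewrite distrC => ->.
by rewrite sub0r normrM normrN ler_wpM2r.
Qed.

(** All derivatives of order 0 to [k] along the one direction [v] exist and are bounded. The class
    is stable under sums, products and dilations, and contains what a [k]-fold difference along [v]
    consumes. *)
Fixpoint dirdiff (k : nat) v g : Prop :=
  (exists M, forall x, `|g x| <= M) /\
  if k is k'.+1 then exists2 g', has_dderiv v g g' & dirdiff k' v g' else True.

Lemma dirdiffW k v g : dirdiff k.+1 v g -> dirdiff k v g.
Proof.
elim: k g => [|k IH] g; first by move=> [].
by move=> [Mg [g' dg g'k]]; split => //; exists g' => //; exact: IH.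
Qed.

Lemma dirdiffD k v f g : dirdiff k v f -> dirdiff k v g ->
  dirdiff k v (fun x => f x + g x).
Proof.
elim: k f g => [|k IH] f g [[Mf fM] hf] [[Mg gM] hg]; split.
- by exists (Mf + Mg) => x; rewrite (le_trans (ler_normD _ _))// lerD.
- by [].
- by exists (Mf + Mg) => x; rewrite (le_trans (ler_normD _ _))// lerD.
- move: hf hg => [f' df hf] [g' dg hg].
  by exists (fun x => f' x + g' x); [exact: has_dderivD|exact: IH].
Qed.

Lemma dirdiffM k v f g : dirdiff k v f -> dirdiff k v g ->
  dirdiff k v (fun x => f x * g x).
Proof.
have bM (u w : V -> R) : (exists M, forall x, `|u x| <= M) ->
    (exists M, forall x, `|w x| <= M) -> exists M, forall x, `|u x * w x| <= M.
  by move=> [M uM] [N wN]; exists (M * N) => x; rewrite normrM ler_pM.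
elim: k f g => [|k IH] f g.
  by move=> [Mf _] [Mg _]; split => //; exact: bM.
(* The product rule pairs each factor with the derivative of the other, so each factor is also
   needed at order [k]. *)
move=> fk gk; have [fk1 gk1] := (dirdiffW fk, dirdiffW gk).
move: fk gk => [Mf [f' df fk']] [Mg [g' dg gk']]; split; first exact: bM.
exists (fun x => f x * g' x + g x * f' x); first exact: has_dderivM.
by apply: dirdiffD; apply: IH.
Qed.

Lemma dirdiffZ k v (c : R) g : dirdiff k v g -> dirdiff k v (fun x => c * g x).
Proof.
elim: k g => [|k IH] g [[M gM] hg]; split => //.
- by exists (`|c| * M) => x; rewrite normrM ler_wpM2l.
- by exists (`|c| * M) => x; rewrite normrM ler_wpM2l.
- move: hg => [g' dg hg].
  by exists (fun x => c * g' x); [exact: has_dderivZ|exact: IH].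
Qed.

Lemma dirdiff_scale k v (a : R) g : dirdiff k v g ->
  dirdiff k v (fun x => g (a *: x)).
Proof.
elim: k g => [|k IH] g [[M gM] hg]; split => //; [by exists M|by exists M|].
move: hg => [g' dg hg]; exists (fun x => a * g' (a *: x)).
  exact: has_dderiv_scale.
by apply: dirdiffZ; exact: IH.
Qed.

Fixpoint fdiff (k : nat) (h : V) g : V -> R :=
  if k is k'.+1 then fun x => fdiff k' h g (x + h) - fdiff k' h g x else g.

Lemma has_dderiv_fdiff k h v g g' : has_dderiv v g g' ->
  has_dderiv v (fdiff k h g) (fdiff k h g').
Proof.
move=> dg; elim: k => [//|k IH] /=.
have := has_dderivD (has_dderiv_shift h IH) (has_dderivZ (-1) IH).
by move=> H x; have := H x; rewrite mulN1r; apply: eq_is_derive_fun => s;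
   rewrite mulN1r.
Qed.

(** Differences commute with differentiation, so the mean value theorem trades the outermost
    difference for one derivative and one factor [|t|]; induction on [k] handles the remaining
    differences of [g']. *)
Lemma fdiff_le k v g : dirdiff k v g ->
  exists2 C, 0 <= C & forall (t : R) x, `|fdiff k (t *: v) g x| <= C * `|t| ^+ k.
Proof.
elim: k g => [|k IH] g.
  move=> [[M gM] _]; exists M; first exact: le_trans (gM 0).
  by move=> t x; rewrite expr0 mulr1.
move=> [_ [g' dg /IH[C C0 hC]]]; exists C => // t x /=.
apply: (le_trans (has_dderiv_le _ _ (has_dderiv_fdiff k (t *: v) dg) (hC t))).
by rewrite -mulrA -exprSr.
Qed.

Lemma fdiff_scale k h (c a : R) g x :
  fdiff k h (fun y => c * g (a *: y)) x = c * fdiff k (a *: h) g (a *: x).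
Proof. by elim: k x => [//|k IH] x /=; rewrite !IH scalerDr mulrBr. Qed.

Lemma fdiff_bounded k h g (M : R) : (forall x, `|g x| <= M) ->
  forall x, `|fdiff k h g x| <= 2 ^+ k * M.
Proof.
move=> gM; elim: k => [|k IH] x /=; first by rewrite expr0 mul1r.
rewrite (le_trans (ler_normB _ _))// exprS -mulrA mulr_natl mulr2n.
by rewrite lerD.
Qed.

Lemma fdiff_support k h g (r : R) :
  (forall x, g x != 0 -> `|x| < r) ->
  forall x, fdiff k h g x != 0 -> `|x| < r + k%:R * `|h|.
Proof.
move=> gr; elim: k => [|k IH] x /=; first by rewrite mul0r addr0; exact: gr.
have [E|/IH xk _] := eqVneq (fdiff k h g x) 0; last first.
  by rewrite (lt_le_trans xk)// lerD2l ler_wpM2r// ler_nat.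
rewrite E subr0 => /IH xk.
have -> : x = (x + h) - h by rewrite addrK.
rewrite (le_lt_trans (ler_normB _ _))// -natr1 mulrDl mul1r addrA ltrD2r.
exact: xk.
Qed.

Lemma measurable_fdiff k h g : measurable_fun setT g ->
  measurable_fun setT (fdiff k h g).
Proof.
move=> mg; elim: k => [//|k IH] /=; apply: measurable_funB => //.
by apply: (measurableT_comp IH); exact: measurable_translate.
Qed.

End directional_derivatives.

(** * Decay of Fourier transforms *)

Section fourier_decay.
Context {R : realType} {n : nat}.
Local Notation V := 'rV[R]_n.
Local Notation mu := (lebesgue_rV R n).
Implicit Types (g : V -> R) (x z : V).

Lemma coord_le_norm x i : `|x 0 i| <= `|x|.
Proof.
rewrite [leRHS]mx_normrE.
exact: (le_bigmax _ (fun ij : 'I_1 * 'I_n => `|x ij.1 ij.2|) (0, i)).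
Qed.

Lemma norm_le_enorm x : `|x| <= enorm x.
Proof.
have [->|x0] := eqVneq x 0; first by rewrite normr0 enorm_ge0.
have : mx_norm x != 0 by rewrite -[mx_norm x]/(`|x|) normr_eq0.
move=> /mx_norm_neq0[[i j] /= xE]; rewrite -[`|x|]/(mx_norm x) xE (ord1 i).
exact: coord_le_enorm.
Qed.

Lemma norm_delta_le1 i : `|delta_mx 0 i : V| <= 1.
Proof.
have [->|d0] := eqVneq `|delta_mx 0 i : V| 0; first by [].
move/mx_norm_neq0 : (d0 : mx_norm (delta_mx 0 i : V) != 0) => [[a b] /= dE].
rewrite -[`|_|]/(mx_norm _) dE mxE.
by case: (_ && _); rewrite ?normr1 ?normr0.
Qed.

Lemma enorm_le_norm x : enorm x <= n%:R * `|x|.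
Proof. by apply: enorm_le => i; exact: coord_le_norm. Qed.

Lemma integral_bounded_support_le g (M r : R) : measurable_fun setT g ->
  (forall x, `|g x| <= M) -> (forall x, g x != 0 -> `|x| < r) -> 0 <= r ->
  (\int[mu]_x `|g x|%:E <= (M * (2 * (n.+1%:R * r)) ^+ n)%:E)%E.
Proof.
move=> mg gM gr r0; have M0 : 0 <= M by apply: le_trans (gM 0).
(* The sup-norm ball must be placed in a Euclidean one. The factor [n.+1] instead of [n] is positive
   in every dimension, which keeps the inequality strict. *)
pose B : set V := eball 0 (n.+1%:R * r).
have mB : measurable B by exact: measurable_eball.
apply: (@le_trans _ _ (\int[mu]_x (M%:E * (\1_B x)%:E))%E).
  apply: ge0_le_integral => //=.
  - by apply/measurable_EFinP; exact: measurableT_comp.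
  - by apply: emeasurable_funM => //; exact/measurable_EFinP/measurable_indic.
  - move=> x _; rewrite -EFinM lee_fin.
    have [->|gx] := eqVneq (g x) 0.
      by rewrite normr0 mulr_ge0.
    rewrite indicE mem_set ?mulr1//= /B /eball/= subr0.
    rewrite (le_lt_trans (enorm_le_norm x))//.
    apply: (@le_lt_trans _ _ (n.+1%:R * `|x|)).
      by rewrite ler_wpM2r// ler_nat.
    by rewrite ltr_pM2l// gr.
rewrite ge0_integralZl_EFin//; last exact/measurable_EFinP/measurable_indic.
rewrite integral_indic// setIT EFinM lee_wpmul2l//.
by apply: lebesgue_eball_le; rewrite mulr_ge0.
Qed.

Local Notation cx g := (fun x => ((g x)%:C)%C).

Lemma cintegrable_bounded_support g (M r : R) : measurable_fun setT g ->
  (forall x, `|g x| <= M) -> (forall x, g x != 0 -> `|x| < r) -> 0 <= r ->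
  cintegrable (cx g).
Proof.
move=> mg gM gr r0; split; first exact: cmfun_real.
under eq_integral do rewrite normc_real.
by apply: le_lt_trans (integral_bounded_support_le mg gM gr r0) _; rewrite ltry.
Qed.

Lemma normc_fourier_L1_bounded_support_le g (M r : R) z : measurable_fun setT g ->
  (forall x, `|g x| <= M) -> (forall x, g x != 0 -> `|x| < r) -> 0 <= r ->
  nC (fourier_L1 (cx g) z) <= 2 * (M * (2 * (n.+1%:R * r)) ^+ n).
Proof.
move=> mg gM gr r0; rewrite -lee_fin EFinM.
apply: (le_trans (normc_fourier_L1_le _ (cmfun_real mg))).
rewrite lee_pmul2l//; under eq_integral do rewrite normc_real.
exact: integral_bounded_support_le.
Qed.

Lemma fourier_L1_shift (f : V -> R[i]) h z : cintegrable f ->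
  fourier_L1 (fun x => f (x + h)) z = expi (dotp h z) * fourier_L1 f z.
Proof.
move=> [mf foo]; have me (u : V) : cmfun (fun x : V => expi (- dotp (x + u) z)).
  apply: cmfun_expi; apply: measurableT_comp => //.
  by apply: measurable_dotp => //; exact: measurable_translate.
have ci (u : V) : cintegrable (fun x => expi (- dotp (x + u) z) * f x).
  apply: (@cintegrable_le _ _ _ (fun x => nC (f x))) => //.
  - exact: cmfunM.
  - exact: measurable_normc.
  - by move=> x; rewrite ComplexField.Normc.normcM normc_expi mul1r.
rewrite /fourier_L1.
transitivity (cintegral (fun x => expi (- dotp (x + h + - h) z) * f (x + h))).
  by apply: eq_cintegral => x; rewrite addrK.
rewrite (cintegral_shift h (ci (- h))) -cintegralZ; last first.
  by have := ci 0; under eq_fun do rewrite addr0.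
apply: eq_cintegral => x; rewrite mulrA -expiD; congr (expi _ * _).
by rewrite dotpDl opprD addrC; congr (_ + _);
  rewrite /dotp -sumrN; apply: eq_bigr => i _; rewrite !mxE mulNr opprK.
Qed.

Lemma fourier_L1_fdiff k g h z (M r : R) : measurable_fun setT g ->
  (forall x, `|g x| <= M) -> (forall x, g x != 0 -> `|x| < r) -> 0 <= r ->
  expi (dotp h z) = -1 ->
  fourier_L1 (cx (fdiff k h g)) z = (- 2) ^+ k * fourier_L1 (cx g) z.
Proof.
move=> mg gM gr r0 hz.
have ci j : cintegrable (cx (fdiff j h g)).
  apply: (cintegrable_bounded_support (M := 2 ^+ j * M)
    (r := r + j%:R * `|h|)).
  - exact: measurable_fdiff.
  - exact: fdiff_bounded.
  - exact: fdiff_support.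
  - by rewrite addr_ge0// mulr_ge0.
elim: k => [|k IH]; first by rewrite expr0 mul1r.
have ciE (f : V -> R[i]) : cintegrable f ->
    cintegrable (fun x => expi (- dotp x z) * f x).
  move=> [mf foo]; apply: (@cintegrable_le _ _ _ (fun x => nC (f x))) => //.
  - apply: cmfunM => //; apply: cmfun_expi; apply: measurableT_comp => //.
    exact: measurable_dotp.
  - exact: measurable_normc.
  - by move=> x; rewrite ComplexField.Normc.normcM normc_expi mul1r.
have cih : cintegrable (fun x => ((fdiff k h g (x + h))%:C)%C).
  apply: (cintegrable_bounded_support (g := fun x => fdiff k h g (x + h))
    (M := 2 ^+ k * M) (r := r + k%:R * `|h| + `|h|)).
  - by apply: (measurableT_comp (measurable_fdiff k h mg));
      exact: measurable_translate.
  - by move=> x; exact: fdiff_bounded.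
  - move=> x /(fdiff_support gr) xh.
    rewrite -(addrK h x) (le_lt_trans (ler_normB _ _))// ltrD2r//.
  - by rewrite !addr_ge0// mulr_ge0.
transitivity (fourier_L1 (fun x => ((fdiff k h g (x + h))%:C)%C) z -
    fourier_L1 (cx (fdiff k h g)) z).
  rewrite /fourier_L1 -cintegralB; [|exact: ciE|exact: ciE].
  by apply: eq_cintegral => x; rewrite -mulrBr -rmorphB.
rewrite (@fourier_L1_shift (cx (fdiff k h g)))// hz IH exprS.
by ring.
Qed.

Lemma enorm_le_coord z : 0 < enorm z -> exists i, enorm z <= n%:R * `|z 0 i|.
Proof.
move=> z0; have : z != 0.
  apply: contraTneq z0 => ->; rewrite -leNgt /enorm /dotp big1 ?sqrtr0// => i _.
  by rewrite mxE mul0r.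
move=> zn; have : mx_norm z != 0 by rewrite -[mx_norm z]/(`|z|) normr_eq0.
move=> /mx_norm_neq0[[i j] /= zE]; exists j.
rewrite (le_trans (enorm_le_norm z))// -[`|z|]/(mx_norm z) zE (ord1 i).
exact: lexx.
Qed.

(* Choose the coordinate z_i realizing the sup norm of z and the step
   h = (pi / z_i) e_i: a finite difference with step h multiplies the Fourier
   transform at z by -2, while N of them cost |h|^N. *)
Lemma fourier_L1_scale_decay g (M r0 : R) (k : nat) : measurable_fun setT g ->
  (forall x, `|g x| <= M) -> (forall x, g x != 0 -> `|x| < r0) -> 0 <= r0 ->
  (forall i, dirdiff k (delta_mx 0 i) g) ->
  exists2 A, 0 <= A & forall (s c : R), 0 < s -> 0 <= c ->
    let w := fourier_L1 (fun x => ((c * g (s^-1 *: x))%:C)%C) in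
    forall z, nC (w z) <= A * c * s ^+ n /\
      (1 <= s * enorm z -> nC (w z) <= A * c * s ^+ n / (s * enorm z) ^+ k).
Proof.
move=> mg gM gr rr0 gd.
have M0 : 0 <= M by apply: le_trans (gM 0).
have /choice[C hC] : forall i, exists C : R, 0 <= C /\ forall (t : R) x,
    `|fdiff k (t *: delta_mx 0 i) g x| <= C * `|t| ^+ k.
  by move=> i; have [C C0 CP] := fdiff_le (gd i); exists C.
pose C1 := \sum_i C i.
have C10 : 0 <= C1 by apply: sumr_ge0 => i _; exact: (hC i).1.
have CC i : C i <= C1.
  by rewrite /C1 (bigD1 i)//= lerDl sumr_ge0// => j _; exact: (hC j).1.
(* [T / rho], with [rho = s * enorm z], will bound the step [pi / (s |z_i|)] seen by the unscaled
   profile, because [enorm z <= n |z_i|] for the chosen coordinate. *)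
pose T : R := pi * n%:R.
have T0 : 0 <= T by rewrite mulr_ge0// pi_ge0.
pose A1 := 2 * (M * (2 * (n.+1%:R * r0)) ^+ n).
(* Each of the [k] differences enlarges the support by at most one step, and steps are at most [T]
   once [rho >= 1]. *)
pose r1 := r0 + k%:R * T.
have r10 : 0 <= r1 by rewrite addr_ge0// mulr_ge0.
pose A2 := 2 * (C1 * T ^+ k * (2 * (n.+1%:R * r1)) ^+ n).
have A10 : 0 <= A1 by rewrite !mulr_ge0// exprn_ge0// !mulr_ge0.
have A20 : 0 <= A2 by rewrite !mulr_ge0// exprn_ge0// !mulr_ge0.
exists (A1 + A2) => [|s c s0 c0 w z]; first exact: addr_ge0.
have sn0 : 0 <= s ^+ n by rewrite exprn_ge0// ltW.
pose gs x := c * g (s^-1 *: x).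
have mgs : measurable_fun setT gs.
  apply: measurable_funM => //; apply: (measurableT_comp mg).
  exact: measurable_scalerV.
have gsM x : `|gs x| <= c * M by rewrite normrM ger0_norm// ler_wpM2l.
have scale_lt x (r : R) : `|s^-1 *: x| < r -> `|x| < s * r.
  by rewrite normrZ gtr0_norm ?invr_gt0// mulrC ltr_pdivrMr// mulrC.
have gsr x : gs x != 0 -> `|x| < s * r0.
  by rewrite /gs mulf_eq0 negb_or => /andP[_ /gr /scale_lt].
have sr0 : 0 <= s * r0 by rewrite mulr_ge0// ltW.
split.
  apply: (le_trans (normc_fourier_L1_bounded_support_le z mgs gsM gsr sr0)).
  apply: (@le_trans _ _ (A1 * c * s ^+ n)); last first.
    by rewrite ler_wpM2r// ler_wpM2r// lerDl.
  rewrite /A1 !exprMn le_eqVlt; apply/orP; left; apply/eqP; ring.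
move=> sz; set rho := s * enorm z.
have rho0 : 0 < rho by exact: lt_le_trans sz.
have z0 : 0 < enorm z by move: rho0; rewrite /rho pmulr_rgt0.
have [i zi] := enorm_le_coord z0.
have zi0 : 0 < `|z 0 i|.
  rewrite lt_neqAle normr_ge0 andbT eq_sym; apply: contraTneq zi => ->.
  by rewrite mulr0 -ltNge.
have zi1 : z 0 i != 0 by rewrite -normr_gt0.
pose h : V := (pi / z 0 i) *: delta_mx 0 i.
have hz : expi (dotp h z) = -1.
  rewrite /dotp (bigD1 i)//= big1 ?addr0 => [|j ji].
    by rewrite !mxE !eqxx mulr1 divfK// expipi.
  by rewrite !mxE (negbTE ji) andbF mulr0 mul0r.
(* A step [h] for the dilated weight is the step [h / s] for [g], that is, [tau] along the axis
   [i]. *)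
pose tau := s^-1 * (pi / z 0 i).
have tauT : `|tau| <= T / rho.
  have -> : `|tau| = pi / (s * `|z 0 i|).
    rewrite /tau 2!normrM 2!normfV (gtr0_norm s0) (ger0_norm (pi_ge0 R)).
    by field; rewrite !gt_eqF.
  rewrite ler_pdivrMr ?mulr_gt0//.
  have -> : T / rho * (s * `|z 0 i|) = pi * (n%:R * `|z 0 i| / enorm z).
    by rewrite /T /rho; field; rewrite !gt_eqF.
  by rewrite ler_peMr ?pi_ge0// ler_pdivlMr// mul1r.
have tauT1 : `|tau| <= T.
  by rewrite (le_trans tauT)// ler_pdivrMr// ler_peMr.
have fE x : fdiff k h gs x = c * fdiff k (tau *: delta_mx 0 i) g (s^-1 *: x).
  by rewrite /gs fdiff_scale /h scalerA.
have dM x : `|fdiff k h gs x| <= c * (C1 * (T / rho) ^+ k).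
  rewrite fE normrM ger0_norm// ler_wpM2l//.
  apply: (le_trans ((hC i).2 tau _)); apply: ler_pM => //.
  - exact: (hC i).1.
  - by rewrite lerXn2r ?nnegrE// divr_ge0// ltW.
have dr x : fdiff k h gs x != 0 -> `|x| < s * r1.
  rewrite fE mulf_eq0 negb_or => /andP[_ /(fdiff_support gr) xr].
  apply: scale_lt; rewrite (lt_le_trans xr)// /r1 lerD2l ler_wpM2l//.
  rewrite normrZ; apply: le_trans tauT1.
  by rewrite ler_piMr// norm_delta_le1.
have md := measurable_fdiff k h mgs.
have sr1 : 0 <= s * r1 by rewrite mulr_ge0// ltW.
have := normc_fourier_L1_bounded_support_le z md dM dr sr1.
rewrite (fourier_L1_fdiff k mgs gsM gsr sr0 hz) ComplexField.Normc.normcM.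
have -> : nC ((-2) ^+ k) = 2 ^+ k :> R.
  have -> : (-2) ^+ k = (((-2) ^+ k : R)%:C)%C :> R[i].
    by rewrite rmorphXn rmorphN rmorph_nat.
  by rewrite normc_real normrX normrN normr_nat.
(* The factor [2 ^ k] in front of the transform is at least 1 and is dropped. *)
move=> H; have {H} : nC (w z) <= 2 * (c * (C1 * (T / rho) ^+ k) *
     (2 * (n.+1%:R * (s * r1))) ^+ n).
  by apply: le_trans H; rewrite ler_peMl ?normc_ge0// exprn_ege1// ler1n.
move=> /le_trans; apply; apply: (@le_trans _ _ (A2 * c * s ^+ n / rho ^+ k)).
  rewrite /A2 expr_div_n; have -> : 2 * (n.+1%:R * (s * r1)) =
    s * (2 * (n.+1%:R * r1)) by ring.
  rewrite [(s * _) ^+ n]exprMn le_eqVlt; apply/orP; left; apply/eqP.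
  by move: (rho ^- k) (T ^+ k) (s ^+ n) ((2 * _) ^+ n) => a b d e; ring.
by rewrite ler_wpM2r ?invr_ge0 ?exprn_ge0 ?(ltW rho0)// ler_wpM2r// ler_wpM2r// lerDr.
Qed.

End fourier_decay.

(** * Littlewood-Paley profiles *)

Section amplitudes.
Context {R : realType} {n : nat}.
Local Notation V := 'rV[R]_n.
Implicit Types (g psi : V -> R) (x v : V).

(** The two difference quotients are the same function. This links the partial derivatives in
    [smooth] with the one-variable form used in [has_dderiv]. *)
Lemma is_derive_line x v g (d : R) :
  is_derive x v g d -> is_derive (0 : R) 1 (fun s : R => g (x + s *: v)) d.
Proof.
have E : (fun h : R => h^-1 *: (((fun s : R => g (x + s *: v)) \o shift 0) (h *: 1)
    - g (x + 0 *: v))) = (fun h => h^-1 *: ((g \o shift x) (h *: v) - g x)).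
  apply/funext => h /=.
  have -> : (h *: (1 : R) : R) + 0 = h by rewrite addr0; exact: mulr1.
  by rewrite scale0r addr0 [x + _]addrC.
move=> [dg <-]; split; first by rewrite /derivable E.
by rewrite /derive E.
Qed.

Lemma continuous_enorm : continuous (@enorm R n).
Proof.
move=> x; apply: (@continuous_comp _ _ _ (fun y : V => dotp y y) Num.sqrt).
  suff : continuous (fun y : V => \sum_(i < n) y 0 i * y 0 i) by apply.
  apply: (@continuous_big R _ +%R 0 xpredT) => [|i _ y].
    exact: add_continuous.
  by apply: continuousM; exact: coord_continuous.
exact: sqrt_continuous.
Qed.

Lemma closed_enorm_le (r : R) : closed [set x : V | enorm x <= r].
Proof.
apply: (@closed_comp _ _ (@enorm R n) [set y : R | y <= r]).
  by move=> x _; exact: continuous_enorm.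
exact: closed_le.
Qed.

Lemma compact_enorm_le (r : R) : compact [set x : V | enorm x <= r].
Proof.
apply: bounded_closed_compact; last exact: closed_enorm_le.
exists r; split; first exact: num_real.
by move=> M rM x /= xr; rewrite (le_trans (norm_le_enorm x))// (le_trans xr)// ltW.
Qed.

Lemma continuous_support_bounded g (r : R) : continuous g -> 0 <= r ->
  (forall x, r < enorm x -> g x = 0) -> exists M : R, forall x, `|g x| <= M.
Proof.
move=> cg r0 gr.
have A0 : [set x : V | enorm x <= r] !=set0.
  by exists 0; rewrite /= /enorm /dotp big1 ?sqrtr0// => i _; rewrite mxE mul0r.
have cn : continuous (fun x => `|g x|).
  by move=> x; apply: continuous_comp; [exact: cg|exact: norm_continuous].
have [c _ cmax] := compact_EVT_max A0 (@compact_enorm_le r)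
  (continuous_subspaceT cn).
exists `|g c| => x; have [xr|xr] := leP (enorm x) r.
  by apply: cmax; rewrite inE.
by rewrite gr// normr0.
Qed.

Definition annular psi := forall x, psi x != 0 -> 2^-1 < enorm x < 2.

(** Repeated derivatives along one axis suffice, since each finite difference is taken along a
    single coordinate direction. *)
Definition pure_dderiv psi (i : 'I_n) k := iter_partial (nseq k i) psi.

(** The strict inequalities describe an open set: a derivative vanishing on it is locally constant
    there, so the next one vanishes there too. *)
Lemma pure_dderiv_annulus psi i k : smooth psi -> annular psi ->
  forall x, enorm x < 2^-1 \/ 2 < enorm x -> pure_dderiv psi i k x = 0.
Proof.
move=> spsi apsi; elim: k => [|k IH] x hx.
  apply/eqP; apply: contraTT isT => /apsi /andP[x1 x2].
  by case: hx => /lt_trans; [move=> /(_ _ x1)|move=> /(_ _ x2)]; rewrite ltxx.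
have nz : \near x, pure_dderiv psi i k x = cst 0 x.
  case: hx => hx.
    near=> y; apply: IH; left; near: y.
    exact: (cvgr_lt _ (@continuous_enorm x) _ hx).
  near=> y; apply: IH; right; near: y.
  exact: (cvgr_gt _ (@continuous_enorm x) _ hx).
by rewrite /pure_dderiv/= (near_eq_derive _ nz) derive_cst.
Unshelve. all: by end_near. Qed.

Lemma pure_dderiv_bounded psi i k : smooth psi -> annular psi ->
  exists M : R, forall x, `|pure_dderiv psi i k x| <= M.
Proof.
move=> spsi apsi; apply: (@continuous_support_bounded _ 2) => //.
  exact: (spsi _).1.
by move=> x hx; apply: pure_dderiv_annulus => //; right.
Qed.

(* The family below is closed under differentiation along e_i. *)
Definition annular_term psi i k (m : nat) (gamma : R) x : R :=
  pure_dderiv psi i k x * (x 0 i ^+ m * enorm x `^ (- gamma)).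

Lemma annular_term_bounded psi i k m gamma : smooth psi -> annular psi ->
  0 <= gamma -> exists M : R, forall x, `|annular_term psi i k m gamma x| <= M.
Proof.
move=> spsi apsi g0; have [M hM] := pure_dderiv_bounded i k spsi apsi.
have M0 : 0 <= M by apply: le_trans (hM 0).
(* On the closed annulus [|x_i| <= 2], and [enorm x >= 1/2] together with [gamma >= 0] gives
   [enorm x ^ (- gamma) <= 2 ^ gamma]. *)
exists (M * (2 ^+ m * 2 `^ gamma)) => x; rewrite /annular_term.
have hB : 0 <= M * (2 ^+ m * 2 `^ gamma).
  by rewrite !mulr_ge0 ?powR_ge0 ?exprn_ge0.
have [x1|x1] := ltP (enorm x) 2^-1.
  by rewrite pure_dderiv_annulus ?mul0r ?normr0//; left.
have [x2|x2] := ltP 2 (enorm x).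
  by rewrite pure_dderiv_annulus ?mul0r ?normr0//; right.
rewrite !normrM; apply: ler_pM => //.
apply: ler_pM => //.
  rewrite normrX lerXn2r ?nnegrE// (le_trans (coord_le_enorm x i))//.
have e0 : 0 < enorm x by apply: lt_le_trans x1; rewrite invr_gt0.
rewrite ger0_norm ?powR_ge0// powRN.
rewrite -[leLHS]mul1r ler_pdivrMr ?powR_gt0// -powRM ?(ltW e0)//.
rewrite -[leLHS](_ : 1 `^ gamma = 1); last by rewrite powR1.
apply: ge0_ler_powR; rewrite ?nnegrE ?mulr_ge0 ?(ltW e0)//.
by rewrite -ler_pdivrMl// mulr1.
Qed.

(** This is the product rule with [d_i |x|^(-gamma) = - gamma x_i |x|^(-(gamma + 2))]. For [m = 0]
    the truncated [m.-1] is harmless, as its coefficient is 0. *)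
Lemma has_dderiv_annular_term psi i k m gamma : smooth psi -> annular psi ->
  has_dderiv (delta_mx 0 i) (annular_term psi i k m gamma)
   (fun x => annular_term psi i k.+1 m gamma x +
      (m%:R * annular_term psi i k m.-1 gamma x +
       (- gamma) * annular_term psi i k m.+1 (gamma + 2) x)).
Proof.
(* The power of the norm is singular at the origin, but inside the hole of the annulus the whole
   term is locally 0. *)
move=> spsi apsi x; have [x1|x1] := ltP (enorm x) 2^-1.
  have -> : annular_term psi i k.+1 m gamma x +
      (m%:R * annular_term psi i k m.-1 gamma x +
       - gamma * annular_term psi i k m.+1 (gamma + 2) x) = 0.
    by rewrite /annular_term !pure_dderiv_annulus ?mul0r ?mulr0 ?addr0//; left.
  apply: is_derive_line.
  have nz : \near x, cst 0 x = annular_term psi i k m gamma x.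
    near=> y; rewrite /annular_term pure_dderiv_annulus ?mul0r//; left; near: y.
    exact: (cvgr_lt _ (@continuous_enorm x) _ x1).
  exact: (near_eq_is_derive nz (is_derive_cst (0 : R) x (delta_mx 0 i : V))).
set e := delta_mx 0 i.
have e0 : 0 < enorm x by apply: lt_le_trans x1; rewrite invr_gt0.
have d1 : is_derive (0 : R) 1 (fun s : R => pure_dderiv psi i k (x + s *: e))
    (pure_dderiv psi i k.+1 x).
  by apply: is_derive_line; apply: derivableP; exact: (spsi _).2.
have dX : is_derive (0 : R) 1 (fun s : R => (x + s *: e) 0 i ^+ m)
    (m%:R * x 0 i ^+ m.-1).
  have d0 : is_derive (0 : R) 1 (fun s : R => x 0 i + s) 1.
    have := is_deriveD (is_derive_cst (x 0 i) (0 : R) (1 : R))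
      (is_derive_id (0 : R) (1 : R)).
    by rewrite add0r.
  have dm := is_deriveX m d0.
  have E : (m%:R * (x 0 i + 0) ^+ m.-1) *: (1 : R) = m%:R * x 0 i ^+ m.-1.
    by rewrite addr0; exact: mulr1.
  rewrite E in dm; move: dm; apply: eq_is_derive_fun => s.
  by rewrite exprfctE /e !mxE !eqxx mulr1.
(* [q] is the squared norm along the line, a polynomial in [s]; writing the power of the norm as
   [q ^ (- gamma / 2)] avoids differentiating the square root. *)
pose q (s : R) : R := dotp x x + (2 * x 0 i * s + s * s).
have qE s : q s = dotp (x + s *: e) (x + s *: e).
  rewrite /q /dotp (bigD1 i)//= [RHS](bigD1 i)//= !mxE !eqxx mulr1.
  rewrite [in RHS](eq_bigr (fun j => x 0 j * x 0 j)) => [|j ji].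
    by ring.
  by rewrite !mxE (negbTE ji) andbF mulr0 addr0.
have q00 : 0 < dotp x x by move: e0; rewrite /enorm sqrtr_gt0.
have dq : is_derive (0 : R) 1 q (2 * x 0 i).
  have dl := is_deriveZ (2 * x 0 i) (is_derive_id (0 : R) (1 : R)).
  have dm := is_deriveM (is_derive_id (0 : R) (1 : R)) (is_derive_id (0 : R) (1 : R)).
  have := is_deriveD (is_derive_cst (dotp x x) (0 : R) (1 : R)) (is_deriveD dl dm).
  rewrite /GRing.scale/= !mul0r !addr0 add0r mulr1.
  by apply: eq_is_derive_fun.
have dN : is_derive (0 : R) 1 (fun s : R => enorm (x + s *: e) `^ (- gamma))
    (- gamma * (x 0 i * enorm x `^ (- (gamma + 2)))).
  have q0E : q 0 = dotp x x by rewrite /q !mulr0 !addr0.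
  have q0 : 0 < q 0 by rewrite q0E.
  have := is_derive1_comp (g := q) (is_derive1_powR (- gamma / 2) q0) dq.
  have -> : - gamma / 2 * q 0 `^ (- gamma / 2 - 1) * (2 * x 0 i) =
      - gamma * (x 0 i * enorm x `^ (- (gamma + 2))).
    rewrite q0E /enorm -(powR12_sqrt (ltW q00)) -powRrM.
    have -> : 2^-1 * - (gamma + 2) = - gamma / 2 - 1 by field.
    by field.
  apply: eq_is_derive_fun => s /=.
  rewrite qE /enorm -powR12_sqrt; last first.
    by rewrite /dotp sumr_ge0// => j _; rewrite -expr2 sqr_ge0.
  by rewrite -powRrM; congr (_ `^ _); rewrite mulrC.
have := is_deriveM d1 (is_deriveM dX dN).
move=> D; apply: (is_derive_eq D); rewrite mulrfctE scale0r addr0.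
rewrite /annular_term /GRing.scale/=.
by rewrite exprS; ring.
Unshelve. all: by end_near. Qed.

Lemma annular_term_dirdiff psi i N : smooth psi -> annular psi ->
  forall k m gamma, 0 <= gamma ->
  dirdiff N (delta_mx 0 i) (annular_term psi i k m gamma).
Proof.
move=> spsi apsi; elim: N => [|N IH] k m gamma g0; split => //;
  try exact: annular_term_bounded.
eexists; first exact: has_dderiv_annular_term.
apply: dirdiffD; first exact: IH.
by apply: dirdiffD; apply: dirdiffZ; apply: IH => //; rewrite addr_ge0.
Qed.

(** These are the properties of a weight at unit scale that the two bounds use. The hole of the
    annulus is no longer recorded: it has served to make [|x|^(-alpha)] differentiable on the
    support, and is subsumed in [dirdiff]. *)
Definition amplitude (N : nat) g : Prop :=
  [/\ measurable_fun setT g, exists M : R, forall x, `|g x| <= M,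
    forall x, g x != 0 -> enorm x < 2 &
    forall i, dirdiff N (delta_mx 0 i) g].

Lemma amplitude_annular N psi (alpha : R) : 0 <= alpha -> smooth psi ->
  annular psi -> amplitude N (fun x => psi x / enorm x `^ alpha).
Proof.
move=> a0 spsi apsi.
have E i : (fun x => psi x / enorm x `^ alpha) = annular_term psi i 0 0 alpha.
  by apply/funext => x; rewrite /annular_term expr0 mul1r powRN.
split.
- apply: measurable_funM; first exact: continuous_measurable_rV (spsi [::]).1.
  have -> : (fun x : V => (enorm x `^ alpha)^-1) = (fun x => enorm x `^ (- alpha)).
    by apply/funext => x; rewrite powRN.
  apply: (@measurableT_comp _ _ _ _ _ _ (@powR R ^~ (- alpha))).
    exact: measurable_powR.
  exact: measurable_enorm.
(* In dimension 0 there is no axis along which to form an [annular_term], but the space is a single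
   point. *)
- have [i _|n0] := pickP 'I_n; last first.
    exists `|psi 0 / enorm (0 : V) `^ alpha| => x.
    by have -> : x = 0 by apply/rowP => i; have := n0 i.
  have := annular_term_bounded i 0 0 spsi apsi a0.
  by rewrite -(E i).
- by move=> x; rewrite mulf_eq0 negb_or => /andP[/apsi /andP[]].
- by move=> i; rewrite (E i); exact: annular_term_dirdiff.
Qed.

Lemma amplitudeM N g psi (a : R) : amplitude N g -> smooth psi -> annular psi ->
  amplitude N (fun x => g x * psi (a *: x)).
Proof.
move=> [mg [M gM] gs gd] spsi apsi.
have cpsi : continuous psi by exact: (spsi [::]).1.
have [M' psiM] : exists M : R, forall x, `|psi x| <= M.
  apply: (@continuous_support_bounded _ 2) => // x x2.
  apply/eqP; apply: contraTT x2 => /apsi /andP[_ x2].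
  by rewrite -leNgt ltW.
split.
- apply: measurable_funM => //.
  apply: measurableT_comp; first exact: continuous_measurable_rV.
  exact: measurable_scalerV.
- by exists (M * M') => x; rewrite normrM ler_pM.
- by move=> x; rewrite mulf_eq0 negb_or => /andP[/gs].
- move=> i; apply: dirdiffM => //; apply: dirdiff_scale.
  (* With both exponents equal to 0 the family contains [psi] itself, so its derivatives need no
     separate treatment. *)
  have -> : psi = annular_term psi i 0 0 0.
    by apply/funext => x; rewrite /annular_term expr0 mul1r oppr0 powRr0 mulr1.
  exact: annular_term_dirdiff.
Qed.

End amplitudes.

(** * Low-frequency and high-frequency bounds for one dyadic piece *)

Section littlewood_paley_pieces.
Context {R : realType} {n : nat}.
Local Notation V := 'rV[R]_n.
Local Notation mu := (lebesgue_rV R n).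
Implicit Types (f fhat : V -> R[i]) (x xi : V) (g w psi : V -> R).

Lemma enormZ (a : R) x : enorm (a *: x) = `|a| * enorm x.
Proof.
rewrite /enorm -sqrtr_sqr -sqrtrM ?sqr_ge0//; congr Num.sqrt.
by rewrite /dotp mulr_sumr; apply: eq_bigr => i _; rewrite !mxE; ring.
Qed.

Definition weighted_inverse w fhat x : R[i] :=
  ((2 * pi) ^- n)%:C%C *
  cintegral (fun xi => (w xi)%:C%C * expi (dotp x xi) * fhat xi).

Lemma cmfun_weighted w fhat x : measurable_fun setT w -> cmfun fhat ->
  cmfun (fun xi => (w xi)%:C%C * expi (dotp x xi) * fhat xi).
Proof.
move=> mw mf; apply: cmfunM => //; apply: cmfunM; first exact: cmfun_real.
by apply: cmfun_expi; exact: measurable_dotp.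
Qed.

Lemma measurable_scale_amplitude g (c s : R) : measurable_fun setT g ->
  measurable_fun setT (fun xi : V => c * g (s^-1 *: xi)).
Proof.
move=> mg; apply: measurable_funM => //; apply: (measurableT_comp mg).
exact: measurable_scalerV.
Qed.

Lemma weighted_low_integral g N : amplitude N g ->
  exists2 A, 0 <= A & forall fhat x (c s : R), cmfun fhat -> 0 <= c -> 0 < s ->
  (\int[mu]_xi (nC (((c * g (s^-1 *: xi))%:C)%C * expi (dotp x xi) * fhat xi))%:E
     <= (A * c * s ^+ n)%:E * HL_maximal_rV fhat 0)%E.
Proof.
move=> [mg [M gM] gs _]; have M0 : 0 <= M by apply: le_trans (gM 0).
(* The support lies in the ball of radius [2 * s], which is contained in a cube of side [4 * s]. *)
exists (M * 4 ^+ n) => [|fhat x c s mf c0 s0]; first by rewrite mulr_ge0// exprn_ge0.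
have H0 := HL_maximal_rV_ge0 fhat 0.
pose B : set V := eball 0 (2 * s).
have mB : measurable B by exact: measurable_eball.
have s20 : 0 < 2 * s by rewrite mulr_gt0.
have mfB : measurable_fun setT ((fun xi => (nC (fhat xi))%:E) \_ B).
  apply/(measurable_restrictT _ _).1 => //.
  by apply: measurable_funTS; exact: measurable_enormc.
apply: (@le_trans _ _ (\int[mu]_xi ((c * M)%:E *
    ((fun xi => (nC (fhat xi))%:E) \_ B) xi))%E).
  apply: ge0_le_integral => //=.
  - by move=> xi _; rewrite lee_fin normc_ge0.
  - apply: measurable_enormc; apply: cmfun_weighted => //.
    exact: measurable_scale_amplitude.
  - by apply: emeasurable_funM.
  - move=> xi _; rewrite !ComplexField.Normc.normcM normc_expi mulr1 normc_real.
    rewrite normrM ger0_norm// patchE.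
    have [->|gx] := eqVneq (g (s^-1 *: xi)) 0.
      rewrite normr0 mulr0 mul0r mule_ge0 ?lee_fin ?mulr_ge0//.
      by case: ifP => // _; rewrite lee_fin normc_ge0.
    rewrite mem_set; last first.
      move: (gs _ gx); rewrite enormZ /B /eball/= subr0 gtr0_norm ?invr_gt0//.
      by rewrite mulrC ltr_pdivrMr.
    by rewrite -EFinM lee_fin ler_wpM2r ?normc_ge0// ler_wpM2l.
rewrite ge0_integralZl_EFin ?mulr_ge0//; last first.
  by move=> xi _; rewrite patchE; case: ifP => // _; rewrite lee_fin normc_ge0.
rewrite -integral_mkcond.
apply: (le_trans (lee_wpmul2l _ (integral_eball_le_HL_maximal 0 mf s20))).
  by rewrite lee_fin mulr_ge0.
rewrite muleA -EFinM lee_wpmul2r// lee_fin le_eqVlt; apply/orP; left; apply/eqP.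
have -> : 2 * (2 * s) = 4 * s by ring.
by rewrite exprMn; ring.
Qed.

Lemma weighted_cintegrable g N fhat x (c s : R) : amplitude N g ->
  cmfun fhat -> 0 <= c -> 0 < s -> (HL_maximal_rV fhat 0 < +oo)%E ->
  cintegrable (fun xi => ((c * g (s^-1 *: xi))%:C)%C * expi (dotp x xi) * fhat xi).
Proof.
move=> ag mf c0 s0 Hoo; have [mg _ _ _] := ag; split.
  by apply: cmfun_weighted => //; exact: measurable_scale_amplitude.
have [A A0 /(_ _ x _ _ mf c0 s0) h] := weighted_low_integral ag.
apply: (le_lt_trans h); rewrite lte_mul_pinfty// lee_fin !mulr_ge0//.
by rewrite exprn_ge0// ltW.
Qed.

Lemma twopi_normc_le (z : R[i]) : nC (((2 * pi) ^- n)%:C%C * z) <= nC z.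
Proof.
rewrite ComplexField.Normc.normcM normc_real ler_piMl ?normc_ge0//.
have p1 : 1 <= 2 * pi :> R by have := @pi_ge2 R; lra.
rewrite ger0_norm ?invr_ge0 ?exprn_ge0 ?(le_trans ler01)//.
by rewrite invf_le1 ?exprn_ege1// exprn_gt0// (lt_le_trans ltr01).
Qed.

Lemma weighted_inverse_low g N : amplitude N g ->
  exists2 A, 0 <= A & forall fhat x (c s : R), cmfun fhat -> 0 <= c -> 0 < s ->
  ((nC (weighted_inverse (fun xi => c * g (s^-1 *: xi))%R fhat x))%:E
     <= (A * c * s ^+ n)%:E * HL_maximal_rV fhat 0)%E.
Proof.
move=> ag; have [A A0 hA] := weighted_low_integral ag; have [mg _ _ _] := ag.
exists (2 * A) => [|fhat x c s mf c0 s0]; first by rewrite mulr_ge0.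
apply: (le_trans (_ : _ <= (nC (cintegral (fun xi =>
   ((c * g (s^-1 *: xi))%:C)%C * expi (dotp x xi) * fhat xi)))%:E)%E).
  by rewrite lee_fin twopi_normc_le.
apply: le_trans (normc_cintegral_le _) _.
  by apply: cmfun_weighted => //; exact: measurable_scale_amplitude.
rewrite -!mulrA EFinM -muleA lee_pmul2l// mulrA; exact: hA.
Qed.

(** The transform [W] of the weight has height [A c s ^ n] and width [1 / s], so its mass is of
    order [A c]: the powers of [s] cancel. Order [n.+1] of differentiability is what
    [integral_decay_le] requires. *)
Lemma weighted_inverse_high g : amplitude n.+1 g ->
  exists2 A, 0 <= A & forall (p : R) f fhat x (c s : R), 1 <= p ->
  in_Lp p%:E f -> fourier_Lp p%:E f fhat -> 0 <= c -> 0 < s ->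
  ((nC (weighted_inverse (fun xi => c * g (s^-1 *: xi))%R fhat x))%:E
     <= (A * c)%:E * HL_maximal_rV f x)%E.
Proof.
move=> [mg [M gM] gs gd].
have gs' y : g y != 0 -> `|y| < 2.
  by move=> /gs; apply: le_lt_trans; exact: norm_le_enorm.
have [A A0 hA] := fourier_L1_scale_decay mg gM gs' (ler0n _ 2) gd.
exists (2 * (A * 2 ^+ n.+1 * 2 ^+ n.+1)) => [|p f fhat x c s p1 fp fhatp c0 s0].
  by rewrite !mulr_ge0 ?exprn_ge0.
have sn0 : 0 < s ^+ n by rewrite exprn_gt0.
apply: (le_trans (_ : _ <= (nC (cintegral (fun xi =>
   ((c * g (s^-1 *: xi))%:C)%C * expi (dotp x xi) * fhat xi)))%:E)%E).
  by rewrite lee_fin twopi_normc_le.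
pose G xi := ((c * g (s^-1 *: xi))%:C)%C : R[i].
have M0 : 0 <= M by apply: le_trans (gM 0).
have Gr : cintegrable G.
  apply: (cintegrable_bounded_support (g := fun xi => c * g (s^-1 *: xi))
     (M := c * M) (r := 2 * s)).
  - exact: measurable_scale_amplitude.
  - by move=> y; rewrite normrM ger0_norm// ler_wpM2l.
  - move=> y; rewrite mulf_eq0 negb_or => /andP[_ /gs'].
    by rewrite normrZ gtr0_norm ?invr_gt0// mulrC ltr_pdivrMr.
  - by rewrite mulr_ge0// ltW.
have GM y : nC (G y) <= c * M.
  by rewrite normc_real normrM ger0_norm// ler_wpM2l.
pose W := fourier_L1 G.
have mW : cmfun W by exact: cmfun_fourier_L1 Gr.1.
have AA : 0 <= A * c * s ^+ n by rewrite !mulr_ge0// ltW.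
have WA z : nC (W z) <= A * c * s ^+ n by have [] := hA s c s0 c0 z.
have Wd z : 1 <= s * enorm z -> nC (W z) <= A * c * s ^+ n / (s * enorm z) ^+ n.+1.
  by have [] := hA s c s0 c0 z.
have mf : cmfun f by case: fp.
have Wi := cintegrable_decay x mW s0 AA WA Wd.
rewrite (_ : cintegral _ =
  cintegral (fun xi => G xi * (expi (dotp x xi) * fhat xi))); last first.
  by apply: eq_cintegral => xi; rewrite mulrA.
rewrite (fourier_Lp_multiplication p1 fp fhatp Gr); first last.
- apply: (bounded_cLnorm_lty Wi (A := A * c * s ^+ n)) => //.
  by apply: hoelder_conj_ge1; rewrite lee_fin.
- by apply: (bounded_cLnorm_lty Gr GM); rewrite lee_fin.
apply: le_trans (normc_cintegral_le _) _; first by apply: cmfunM => //; exact: Wi.1.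
have := integral_decay_le x mf mW s0 AA WA Wd.
move=> /(lee_wpmul2l (_ : 0 <= 2%:E)%E) => /(_ _)/le_trans; apply.
  by rewrite lee_fin.
rewrite muleA -EFinM lee_wpmul2r ?HL_maximal_rV_ge0// lee_fin.
rewrite le_eqVlt; apply/orP; left; apply/eqP.
by field; rewrite gt_eqF.
Qed.

End littlewood_paley_pieces.

(** * Sums over the integers *)

Section sums_over_int.
Context {R : realType}.
Implicit Types (a b : int -> R[i]) (s t : R[i]).

(** The norm of [R[i]] takes values in [R[i]], so the generic epsilon is a complex number; its
    positivity forces a zero imaginary part, which allows real ones. *)
Lemma cvgCP (u : nat -> R[i]) (l : (R[i] : numFieldType)) :
  (u : nat -> (R[i] : numFieldType)) @ \oo --> l <->
  forall e : R, 0 < e -> \forall k \near \oo, nC (l - u k) < e.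
Proof.
split=> [/cvgrPdist_lt ul e e0|ul].
  have e0C : 0 < (e%:C)%C :> R[i] by rewrite ltcR.
  apply: filterS (ul _ e0C) => k.
  by rewrite -[`|_|]/((nC (l - u k))%:C)%C ltcR.
apply/cvgrPdist_lt => e; rewrite ltcE => /andP[/eqP Ie Re].
apply: filterS (ul _ Re) => k uk.
rewrite -[`|_|]/((nC (l - u k))%:C)%C ltcE /= uk andbT.
by rewrite /= in Ie; rewrite Ie.
Qed.

Lemma cvgC_ReIm (u : nat -> R[i]) (l : (R[i] : numFieldType)) :
  (fun k => cRe (u k)) @ \oo --> cRe l -> (fun k => cIm (u k)) @ \oo --> cIm l ->
  (u : nat -> (R[i] : numFieldType)) @ \oo --> l.
Proof.
move=> /cvgrPdist_lt ur /cvgrPdist_lt ui; apply/cvgCP => e e0.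
have e20 : 0 < e / 2 by rewrite divr_gt0.
near=> k; apply: (le_lt_trans (normc_le_ReIm _)).
rewrite ReD ReN ImD ImN [ltRHS]splitr; apply: ltrD; near: k.
  exact: ur.
exact: ui.
Unshelve. all: by end_near. Qed.

Lemma Re_sum (u : nat -> R[i]) m : cRe (\sum_(0 <= k < m) u k) =
  \sum_(0 <= k < m) cRe (u k).
Proof.
by elim: m => [|m IH]; rewrite ?big_nil// !big_nat_recr//= ReD IH.
Qed.

Lemma Im_sum (u : nat -> R[i]) m : cIm (\sum_(0 <= k < m) u k) =
  \sum_(0 <= k < m) cIm (u k).
Proof.
by elim: m => [|m IH]; rewrite ?big_nil// !big_nat_recr//= ImD IH.
Qed.

Lemma is_cvg_geometric_bound (u : nat -> R) (B q : R) : 0 <= q < 1 ->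
  (forall k, `|u k| <= B * q ^+ k) -> cvgn (series u).
Proof.
move=> /andP[q0 q1] uB; apply: normed_cvg.
apply: (series_le_cvg (v_ := geometric B q)) => //.
- by move=> k /=.
- by move=> k /=; apply: le_trans (uB k).
- by apply: is_cvg_geometric_series; rewrite ger0_norm.
Qed.

Lemma cvg_series_geometric_bound (u : nat -> R[i]) (B q : R) : 0 <= q < 1 ->
  (forall k, nC (u k) <= B * q ^+ k) ->
  exists l : (R[i] : numFieldType), series u @ \oo --> l.
Proof.
move=> q01 uB.
have /cvg_ex[/= x xP] : cvgn (series (fun k => cRe (u k))).
  apply: (is_cvg_geometric_bound (B := B) q01) => k.
  exact: le_trans (Re_le_normc _) (uB k).
have /cvg_ex[/= y yP] : cvgn (series (fun k => cIm (u k))).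
  apply: (is_cvg_geometric_bound (B := B) q01) => k.
  exact: le_trans (Im_le_normc _) (uB k).
exists (x +i* y)%C; apply: cvgC_ReIm => /=.
  by under eq_fun do rewrite Re_sum.
by under eq_fun do rewrite Im_sum.
Qed.

Lemma geometric_sum_le (B q : R) m : 0 <= B -> 0 <= q < 1 ->
  \sum_(0 <= k < m) B * q ^+ k <= B / (1 - q).
Proof.
move=> B0 /andP[q0 q1]; have q10 : 0 < 1 - q by rewrite subr_gt0.
rewrite -mulr_sumr ler_wpM2l// -[leRHS]mul1r ler_pdivlMr//.
rewrite big_mkord mulrC -[X in _ - X]/(q) -opprB mulNr -subrX1 opprB.
by rewrite lerBlDr lerDl exprn_ge0.
Qed.

Lemma normc_sum_le (u : nat -> R[i]) m :
  nC (\sum_(0 <= k < m) u k) <= \sum_(0 <= k < m) nC (u k).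
Proof.
elim: m => [|m IH]; first by rewrite !big_nil ComplexField.Normc.normc0.
by rewrite !big_nat_recr//= (le_trans (le_normcD _ _))// lerD.
Qed.

Lemma normc_series_le (u : nat -> R[i]) (l : (R[i] : numFieldType)) (B q : R) :
  0 <= B -> 0 <= q < 1 -> (forall k, nC (u k) <= B * q ^+ k) ->
  series u @ \oo --> l -> nC l <= B / (1 - q).
Proof.
move=> B0 q01 uB /cvgCP ul; apply/ler_addgt0Pr => e /ul[m _ /(_ m (leqnn m)) ml].
have -> : l = (l - series u m) + series u m by rewrite subrK.
rewrite (le_trans (le_normcD _ _))// addrC; apply: lerD; last exact: ltW.
apply: (le_trans (normc_sum_le u m)); apply: le_trans (geometric_sum_le m B0 q01).
exact: ler_sum.
Qed.

Lemma is_sumZ_geometric_bound a (B1 q1 B2 q2 : R) : 0 <= q1 < 1 -> 0 <= q2 < 1 ->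
  (forall k : nat, nC (a k%:Z) <= B1 * q1 ^+ k) ->
  (forall k : nat, nC (a (- k.+1%:Z)) <= B2 * q2 ^+ k) ->
  exists s, is_sumZ a s.
Proof.
move=> q1P q2P a1 a2.
have [s1 h1] := cvg_series_geometric_bound q1P a1.
have [s2 h2] := cvg_series_geometric_bound q2P a2.
exists (s1 + s2), s1, s2; split.
- exact: h1.
- exact: h2.
- by [].
Qed.

Lemma normc_is_sumZ_le a s (B1 q1 B2 q2 : R) :
  0 <= B1 -> 0 <= B2 -> 0 <= q1 < 1 -> 0 <= q2 < 1 ->
  (forall k : nat, nC (a k%:Z) <= B1 * q1 ^+ k) ->
  (forall k : nat, nC (a (- k.+1%:Z)) <= B2 * q2 ^+ k) ->
  is_sumZ a s -> nC s <= B1 / (1 - q1) + B2 / (1 - q2).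
Proof.
move=> B10 B20 q1P q2P a1 a2 [s1 [s2 [h1 h2 ->]]].
rewrite (le_trans (le_normcD _ _))// lerD//.
  exact: (normc_series_le B10 q1P a1 h1).
exact: (normc_series_le B20 q2P a2 h2).
Qed.

Lemma cvgCD (u v : nat -> R[i]) (l m : (R[i] : numFieldType)) :
  series u @ \oo --> l -> series v @ \oo --> m ->
  series (fun k => u k + v k) @ \oo --> (l + m : (R[i] : numFieldType)).
Proof.
move=> /cvgCP ul /cvgCP vm; apply/cvgCP => e e0.
have e20 : 0 < e / 2 by rewrite divr_gt0.
near=> k; rewrite (_ : l + m - _ = (l - series u k) + (m - series v k)); last first.
  by rewrite /series/= big_split/= opprD addrACA.
rewrite (le_lt_trans (le_normcD _ _))// [ltRHS]splitr; apply: ltrD; near: k.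
  exact: ul.
exact: vm.
Unshelve. all: by end_near. Qed.

Lemma is_sumZD a b s t : is_sumZ a s -> is_sumZ b t ->
  is_sumZ (fun j => a j + b j) (s + t).
Proof.
move=> [s1 [s2 [a1 a2 ->]]] [t1 [t2 [b1 b2 ->]]].
exists (s1 + t1), (s2 + t2); split; last by rewrite addrACA.
  exact: (cvgCD a1 b1).
exact: (cvgCD a2 b2).
Qed.

Lemma is_sumZ0 : is_sumZ (fun _ => 0 : R[i]) 0.
Proof.
exists 0, 0; rewrite addr0.
have h : series (fun _ : nat => 0 : (R[i] : numFieldType)) @ \oo -->
    (0 : (R[i] : numFieldType)).
  rewrite (_ : series _ = cst 0); first exact: cvg_cst.
  by apply/funext => k; rewrite /series/= big1.
by split.
Qed.

(** The term [a 0] leaves the half-series over nonnegative indices and becomes the first term of the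
    other one; the total is unchanged. *)
Lemma is_sumZ_succ a s : is_sumZ a s -> is_sumZ (fun j => a (j + 1)%Z) s.
Proof.
move=> [s1 [s2 [a1 a2 ->]]]; exists (s1 - a 0), (a 0 + s2); split.
- apply/cvgCP => e e0; have /cvgCP := a1.
  move=> /(_ e e0)[m _ hm]; exists m => // k /= mk.
  rewrite (_ : s1 - a 0 - _ = s1 - series (fun k : nat => a k%:Z) k.+1).
    by apply: hm; rewrite /= leqW.
  rewrite /series/= big_nat_recl// -addrA -opprD; congr (_ - (_ + _)).
  by apply: eq_bigr => i _; rewrite intS addrC.
- apply/cvgCP => e e0; have /cvgCP := a2.
  move=> /(_ e e0)[m _ hm]; exists m.+1 => // -[//|k] /= mk.
  rewrite (_ : a 0 + s2 - _ = s2 - series (fun k : nat => a (- k.+1%:Z)) k).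
    exact: hm.
  rewrite /series/= big_nat_recl// opprD addrACA.
  rewrite (_ : - 1%:Z + 1 = 0 :> int) ?subrr ?add0r//; congr (_ - _).
  by apply: eq_bigr => i _; congr (a _); rewrite !intS; lia.
- by rewrite addrA subrK.
Qed.

Lemma is_sumZ_pred a s : is_sumZ a s -> is_sumZ (fun j => a (j - 1)%Z) s.
Proof.
move=> [s1 [s2 [a1 a2 ->]]]; exists (a (- 1) + s1), (s2 - a (- 1)); split.
- apply/cvgCP => e e0; have /cvgCP := a1.
  move=> /(_ e e0)[m _ hm]; exists m.+1 => // -[//|k] /= mk.
  rewrite (_ : a (- 1) + s1 - _ = s1 - series (fun k : nat => a k%:Z) k).
    exact: hm.
  rewrite /series/= big_nat_recl// opprD addrACA sub0r subrr add0r; congr (_ - _).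
  by apply: eq_bigr => i _; congr (a _); rewrite !intS; lia.
- apply/cvgCP => e e0; have /cvgCP := a2.
  move=> /(_ e e0)[m _ hm]; exists m => // k /= mk.
  rewrite (_ : s2 - a (- 1) - _ = s2 - series (fun k : nat => a (- k.+1%:Z)) k.+1).
    by apply: hm; rewrite /= leqW.
  rewrite /series/= big_nat_recl// -addrA -opprD; congr (_ - (_ + _)).
  by apply: eq_bigr => i _; congr (a _); rewrite !intS; lia.
- rewrite [a _ + s1]addrC -addrA; congr (_ + _).
  by rewrite [RHS]addrC subrK.
Qed.

Lemma is_sumZ_shift a s (d : int) : is_sumZ a s -> is_sumZ (fun j => a (j + d)%Z) s.
Proof.
have shiftn (e : int) k b t :
    (forall b t, is_sumZ b t -> is_sumZ (fun j => b (j + e)%Z) t) ->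
    is_sumZ b t -> is_sumZ (fun j => b (j + e *+ k)%Z) t.
  move=> he; elim: k b => [|k IH] b bt.
    by under eq_fun do rewrite mulr0n addr0.
  have := he _ _ (IH _ bt); congr is_sumZ; apply/funext => j.
  by rewrite mulrS addrA.
move=> hs; case: d => k.
  have := shiftn 1 k a s is_sumZ_succ hs; congr is_sumZ; apply/funext => j.
  by congr (a (_ + _)); lia.
(* The negative constructor of [int] applied to [k] stands for [- (k + 1)], hence [k.+1] steps. *)
have := shiftn (- 1) k.+1 a s is_sumZ_pred hs; congr is_sumZ; apply/funext => j.
by congr (a (_ + _)); lia.
Qed.

End sums_over_int.

(** * Summation of the dyadic pieces *)

Section littlewood_paley_sums.
Context {R : realType}.

Lemma powR_exp2z (j : int) (r : R) : (2 ^ j) `^ r = (2 `^ r) ^ j.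
Proof.
rewrite -powR_intmul// -powRrM mulrC powRrM powR_intmul//.
Qed.

Lemma exp2z_gt0 (j : int) : 0 < (2 : R) ^ j.
Proof. by rewrite exprz_gt0. Qed.

Lemma dyadic_floor (lambda : R) : 0 < lambda ->
  exists j : int, 2 ^ j <= lambda < 2 * 2 ^ j.
Proof.
move=> l0; have ln2 : 0 < ln 2 :> R by rewrite ln_gt0// ltr1n.
exists (Num.floor (ln lambda / ln 2)); set t := _ / _.
have lE : lambda = 2 `^ t.
  by rewrite /powR gt_eqF// /t divfK ?gt_eqF// lnK.
rewrite [X in _ <= X]lE [X in X < _]lE -powR_intmul//.
rewrite ler_powR ?ler1n ?Num.Theory.floor_le//=.
rewrite -[X in X * _](@powRr1 _ 2)// -powRD; last by rewrite pnatr_eq0 implybT.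
rewrite /powR gt_eqF// ltr_expR ltr_pM2r// addrC.
by have := floorD1_gt t; rewrite intrD.
Qed.

(** The two summands come from the geometric series of ratio [2 ^ (- alpha)] and [2 ^ (- beta)]. The
    extra [2 ^ alpha] pays for replacing [lambda] by a power of 2 below it, which enlarges a
    negative power. *)
Definition lp_constant (alpha beta : R) : R :=
  2 `^ alpha / (1 - 2 `^ (- alpha)) + (1 - 2 `^ (- beta))^-1.

Lemma powR2N_lt1 (r : R) : 0 < r -> 0 <= 2 `^ (- r) < 1.
Proof.
move=> r0; rewrite powR_ge0/= powRN invf_lt1 ?powR_gt0//.
by rewrite /powR pnatr_eq0/= expR_gt1 mulr_gt0// ln_gt0// ltr1n.
Qed.

Lemma powR_exp2z_pos (r : R) (k : nat) : (2 ^ k%:Z) `^ r = (2 `^ r) ^+ k.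
Proof. by rewrite powR_exp2z. Qed.

Lemma powR_exp2z_neg (r : R) (k : nat) :
  (2 ^ (- k.+1%:Z)) `^ r = (2 `^ (- r)) ^+ k.+1.
Proof. by rewrite powR_exp2z powRN -exprz_inv. Qed.

Section dyadic_bounds.
Variables (alpha beta : R).
Hypotheses (alpha0 : 0 < alpha) (beta0 : 0 < beta).
Variables (a : int -> R[i]) (A mf mh : R).
Hypotheses (A0 : 0 <= A) (mf0 : 0 <= mf) (mh0 : 0 <= mh).
Hypothesis a_high : forall j, nC (a j) <= A * (2 ^ j) `^ (- alpha) * mf.
Hypothesis a_low : forall j, nC (a j) <= A * (2 ^ j) `^ beta * mh.

Let high_geometric (d : int) (k : nat) : nC (a (k%:Z + d)) <=
  (A * (2 ^ d) `^ (- alpha) * mf) * (2 `^ (- alpha)) ^+ k.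
Proof.
apply: (le_trans (a_high _)); rewrite expfzDr ?pnatr_eq0//.
rewrite powRM ?(ltW (exp2z_gt0 _))// powR_exp2z_pos.
by rewrite le_eqVlt; apply/orP; left; apply/eqP; ring.
Qed.

Let low_geometric (d : int) (k : nat) : nC (a (- k.+1%:Z + d)) <=
  (A * (2 ^ d) `^ beta * mh) * (2 `^ (- beta)) ^+ k.
Proof.
apply: (le_trans (a_low _)); rewrite expfzDr ?pnatr_eq0//.
rewrite powRM ?(ltW (exp2z_gt0 _))// powR_exp2z_neg.
have /andP[q0 q1] := powR2N_lt1 beta0.
(* The negative half starts at index -1, so the exponent is [k.+1]; the surplus factor
   [2 ^ (- beta)], at most 1, is given up. *)
rewrite exprS [leLHS](_ : _ = (A * (2 ^ d) `^ beta * mh * 2 `^ (- beta) ^+ k) *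
  2 `^ (- beta)); last by ring.
by rewrite ler_piMr ?(ltW q1)// !mulr_ge0 ?powR_ge0 ?exprn_ge0.
Qed.

Lemma is_sumZ_dyadic : exists s, is_sumZ a s.
Proof.
apply: (is_sumZ_geometric_bound (powR2N_lt1 alpha0) (powR2N_lt1 beta0)).
  by move=> k; have := high_geometric 0 k; rewrite addr0; exact.
by move=> k; have := low_geometric 0 k; rewrite addr0; exact.
Qed.

Lemma normc_is_sumZ_dyadic_le (s : R[i]) (lambda : R) : 0 < lambda ->
  is_sumZ a s ->
  nC s <= A * lp_constant alpha beta *
    (lambda `^ beta * mh + lambda `^ (- alpha) * mf).
Proof.
(* [is_sumZ] always splits at index 0; shifting by [d], with [2 ^ d] just below [lambda], moves the
   split to the desired frequency. *)
move=> l0 /is_sumZ_shift as_; have [d /andP[d1 d2]] := dyadic_floor l0.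
have /andP[qa0 qa1] := powR2N_lt1 alpha0.
have /andP[qb0 qb1] := powR2N_lt1 beta0.
have ha : 0 < 1 - 2 `^ (- alpha) :> R by rewrite subr_gt0.
have hb : 0 < 1 - 2 `^ (- beta) :> R by rewrite subr_gt0.
have B1 : 0 <= A * (2 ^ d) `^ (- alpha) * mf by rewrite !mulr_ge0// powR_ge0.
have B2 : 0 <= A * (2 ^ d) `^ beta * mh by rewrite !mulr_ge0// powR_ge0.
have := normc_is_sumZ_le B1 B2 (powR2N_lt1 alpha0) (powR2N_lt1 beta0)
  (high_geometric d) (low_geometric d) (as_ d).
move=> /le_trans; apply.
have e1 : (2 ^ d) `^ (- alpha) <= 2 `^ alpha * lambda `^ (- alpha).
  rewrite [leLHS]powRN [X in _ <= _ * X]powRN ler_pdivlMr ?powR_gt0// mulrC.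
  rewrite ler_pdivrMr ?powR_gt0 ?exp2z_gt0// -powRM ?(ltW (exp2z_gt0 _))//.
  by apply: ge0_ler_powR; rewrite ?nnegrE ?mulr_ge0 ?(ltW (exp2z_gt0 _)) ?ltW.
have e2 : (2 ^ d) `^ beta <= lambda `^ beta.
  by apply: ge0_ler_powR; rewrite ?nnegrE ?(ltW (exp2z_gt0 _)) ?(ltW l0) ?(ltW beta0).
pose X := lambda `^ beta * mh; pose Y := lambda `^ (- alpha) * mf.
have X0 : 0 <= X by rewrite mulr_ge0// powR_ge0.
have Y0 : 0 <= Y by rewrite mulr_ge0// powR_ge0.
apply: (@le_trans _ _ (A * (2 `^ alpha / (1 - 2 `^ (- alpha))) * Y +
    A * (1 - 2 `^ (- beta))^-1 * X)).
  apply: lerD.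
    rewrite [leRHS](_ : _ = (A * (2 `^ alpha * lambda `^ (- alpha)) * mf) /
      (1 - 2 `^ (- alpha))); last by rewrite /Y; ring.
    by rewrite ler_wpM2r ?invr_ge0 ?(ltW ha)// ler_wpM2r// ler_wpM2l.
  rewrite [leRHS](_ : _ = (A * lambda `^ beta * mh) /
    (1 - 2 `^ (- beta))); last by rewrite /X; ring.
  by rewrite ler_wpM2r ?invr_ge0 ?(ltW hb)// ler_wpM2r// ler_wpM2l.
rewrite /lp_constant -/X -/Y.
set u := 2 `^ alpha / _; set w := (1 - 2 `^ (- beta))^-1.
have u0 : 0 <= u by rewrite divr_ge0 ?powR_ge0// ltW.
have w0 : 0 <= w by rewrite invr_ge0 ltW.
(* The nonnegative cross terms are added so that a single constant factors out. *)
rewrite [leRHS](_ : _ = (A * u * Y + A * w * X) + (A * u * X + A * w * Y)); last by ring.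
by rewrite lerDl addr_ge0// mulr_ge0// mulr_ge0.
Qed.

End dyadic_bounds.
End littlewood_paley_sums.

(** * Comparison of two dyadic partitions of unity *)

Section littlewood_paley_decomposition.
Context {R : realType} {n : nat}.
Local Notation V := 'rV[R]_n.
Implicit Types (f fhat : V -> R[i]) (x xi : V) (g psi : V -> R).

Lemma lp_annular psi : littlewood_paley psi -> annular psi.
Proof. by case. Qed.

Lemma lp_smooth psi : littlewood_paley psi -> smooth psi.
Proof. by case. Qed.

Lemma lp_supp psi (k : int) xi : littlewood_paley psi ->
  psi ((2 ^ k)^-1 *: xi) != 0 -> 2 ^ (k - 1) < enorm xi < 2 ^ (k + 1).
Proof.
move=> [_ hpsi _] /hpsi; rewrite enormZ gtr0_norm ?invr_gt0 ?exp2z_gt0//.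
rewrite !expfzDr ?pnatr_eq0// expr1z.
by rewrite ltr_pdivlMl ?exp2z_gt0// ltr_pdivrMl ?exp2z_gt0//.
Qed.

(** At a point where [psi_j] is nonzero, its norm lies between [2 ^ (j - 1)] and [2 ^ (j + 1)]; a
    nonzero [psi0_k] there needs [k - 1 < j + 1] and [j - 1 < k + 1], so only three terms of the
    partition by [psi0] survive. *)
Lemma lp_partition psi0 psi (j : int) xi :
  littlewood_paley psi0 -> littlewood_paley psi ->
  psi ((2 ^ j)^-1 *: xi) =
  psi ((2 ^ j)^-1 *: xi) * psi0 ((2 ^ (j - 1))^-1 *: xi) +
  psi ((2 ^ j)^-1 *: xi) * psi0 ((2 ^ j)^-1 *: xi) +
  psi ((2 ^ j)^-1 *: xi) * psi0 ((2 ^ (j + 1))^-1 *: xi).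
Proof.
move=> L0 L; have [->|psij] := eqVneq (psi ((2 ^ j)^-1 *: xi)) 0.
  by rewrite !mul0r !addr0.
have /andP[j1 j2] := lp_supp L psij.
have xi0 : xi != 0.
  apply: contraTneq j1 => ->; rewrite -leNgt /enorm /dotp big1 ?sqrtr0.
    by rewrite ltW// exp2z_gt0.
  by move=> i _; rewrite mxE mul0r.
have [_ _ /(_ xi xi0)] := L0.
rewrite (fsbigE [:: j - 1; j; j + 1])//=.
- rewrite !big_cons big_nil !in_setT addr0 -!mulrDr addrA => ->.
  by rewrite mulr1.
- by rewrite !inE !andbT; lia.
- move=> k _ kj; apply/eqP; apply: contraNT kj => /(lp_supp L0) /andP[k1 k2].
  have := lt_trans j1 k2; have := lt_trans k1 j2.
  by rewrite !ltr_eXz2l ?ltr1n// !inE; lia.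
Qed.

End littlewood_paley_decomposition.

(** * Bounds on the pieces of the fractional integral, independence of psi, and the estimate at a
    given lambda *)

Section fractional_integral.
Context {R : realType} {n : nat} (alpha : R).
Hypothesis alpha_gt0 : 0 < alpha.
Local Notation V := 'rV[R]_n.
Implicit Types (f fhat : V -> R[i]) (x xi : V) (g psi : V -> R).

Let beta : R := n%:R - alpha.

Definition riesz_profile psi (y : V) : R := psi y / enorm y `^ alpha.

Lemma riesz_profileE psi (j : int) xi :
  psi ((2 ^ j)^-1 *: xi) / enorm xi `^ alpha =
  (2 ^ j) `^ (- alpha) * riesz_profile psi ((2 ^ j)^-1 *: xi).
Proof.
have j0 : 0 < (2 : R) ^ j := exp2z_gt0 j.
rewrite /riesz_profile enormZ gtr0_norm ?invr_gt0//.
have E : (2 ^ j)^-1 `^ alpha = ((2 ^ j) `^ alpha)^-1 :> R.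
  by rewrite -powRN -[in LHS]powR_inv1 ?(ltW j0)// -powRrM mulN1r.
rewrite powRM ?invr_ge0 ?enorm_ge0 ?(ltW j0)// powRN E invfM invrK.
by rewrite mulrCA; congr (_ * _); rewrite mulrA mulVf ?mul1r// gt_eqF// powR_gt0.
Qed.

Definition dyadic_weight g (j : int) : V -> R :=
  fun xi => (2 ^ j) `^ (- alpha) * g ((2 ^ j)^-1 *: xi).

Lemma frac_int_pieceE psi fhat x j :
  frac_int_piece psi alpha fhat x j =
  weighted_inverse (dyadic_weight (riesz_profile psi) j) fhat x.
Proof.
rewrite /frac_int_piece /weighted_inverse; congr (_ * _).
by apply: eq_cintegral => xi; rewrite riesz_profileE.
Qed.

Lemma powR_scale (j : int) : (2 ^ j) `^ (- alpha) * (2 ^ j) ^+ n = (2 ^ j) `^ beta :> R.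
Proof.
have j0 : 0 < (2 : R) ^ j := exp2z_gt0 j.
rewrite -powR_mulrn ?(ltW j0)// -powRD; last by rewrite (gt_eqF j0) implybT.
by rewrite addrC.
Qed.

Lemma dyadic_weight_bounds g : amplitude n.+1 g ->
  exists2 A, 0 <= A & forall (p : R) f fhat x (j : int), 1 <= p ->
  in_Lp p%:E f -> fourier_Lp p%:E f fhat ->
  ((nC (weighted_inverse (dyadic_weight g j) fhat x))%:E
     <= (A * (2 ^ j) `^ (- alpha))%:E * HL_maximal_rV f x)%E /\
  ((nC (weighted_inverse (dyadic_weight g j) fhat x))%:E
     <= (A * (2 ^ j) `^ beta)%:E * HL_maximal_rV fhat 0)%E.
Proof.
move=> ag; have [A A0 hA] := weighted_inverse_high ag.
have [B B0 hB] := weighted_inverse_low ag.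
(* Both bounds are instances with scale [2 ^ j] and coefficient [(2 ^ j) ^ (- alpha)]; the sum
   provides one constant for the two. *)
exists (A + B) => [|p f fhat x j p1 fp fhatp]; first exact: addr_ge0.
have j0 : 0 < (2 : R) ^ j := exp2z_gt0 j.
have c0 : 0 <= (2 ^ j) `^ (- alpha) :> R by exact: powR_ge0.
have mfh : cmfun fhat by exact: cmfun_fourier_Lp fhatp.
split.
  apply: (le_trans (hA p f fhat x _ _ p1 fp fhatp c0 j0)).
  by rewrite lee_wpmul2r ?HL_maximal_rV_ge0// lee_fin ler_wpM2r// lerDl.
apply: (le_trans (hB fhat x _ _ mfh c0 j0)).
rewrite lee_wpmul2r ?HL_maximal_rV_ge0// lee_fin -mulrA powR_scale.
by rewrite ler_wpM2r ?powR_ge0// lerDr.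
Qed.

Lemma lp_amplitude psi : littlewood_paley psi -> amplitude n.+1 (riesz_profile psi).
Proof.
move=> L; apply: amplitude_annular; [exact: ltW|exact: lp_smooth|exact: lp_annular].
Qed.

Definition product_profile psi psi0 (d : int) (y : V) : R :=
  riesz_profile psi y * psi0 ((2 ^ d)^-1 *: y).

Lemma product_amplitude psi psi0 d : littlewood_paley psi ->
  littlewood_paley psi0 -> amplitude n.+1 (product_profile psi psi0 d).
Proof.
move=> L L0; apply: amplitudeM; [exact: lp_amplitude|exact: lp_smooth|exact: lp_annular].
Qed.

Lemma product_weightE psi psi0 (j d : int) xi :
  dyadic_weight (product_profile psi psi0 d) j xi =
  psi ((2 ^ j)^-1 *: xi) * psi0 ((2 ^ (j + d))^-1 *: xi) / enorm xi `^ alpha.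
Proof.
rewrite /dyadic_weight /product_profile mulrA -riesz_profileE mulrAC.
by rewrite expfzDr ?pnatr_eq0// invfM scalerA [(2 ^ d)^-1 * _]mulrC.
Qed.

(** With [k = j + d], the product [psi_j psi0_k] is also [psi0_k psi_(k - d)]: exchanging the two
    functions reverses the offset and shifts the index. *)
Lemma product_weightC psi psi0 (j d : int) :
  dyadic_weight (product_profile psi psi0 d) j =
  dyadic_weight (product_profile psi0 psi (- d)) (j + d).
Proof.
by apply/funext => xi; rewrite !product_weightE addrK [psi _ * _]mulrC.
Qed.

Lemma frac_int_piece_partition psi psi0 fhat x (j : int) :
  littlewood_paley psi -> littlewood_paley psi0 -> cmfun fhat ->
  (HL_maximal_rV fhat 0 < +oo)%E ->
  frac_int_piece psi alpha fhat x j =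
  weighted_inverse (dyadic_weight (product_profile psi psi0 (- 1)) j) fhat x +
  weighted_inverse (dyadic_weight (product_profile psi psi0 0) j) fhat x +
  weighted_inverse (dyadic_weight (product_profile psi psi0 1) j) fhat x.
Proof.
move=> L L0 mf Hoo; have j0 : 0 < (2 : R) ^ j := exp2z_gt0 j.
have ci d : cintegrable (fun xi =>
    (dyadic_weight (product_profile psi psi0 d) j xi)%:C%C *
    expi (dotp x xi) * fhat xi).
  apply: (weighted_cintegrable x (product_amplitude d L L0) mf _ j0 Hoo).
  exact: powR_ge0.
rewrite /frac_int_piece /weighted_inverse -!mulrDr; congr (_ * _).
have cD (u v : V -> R[i]) : cintegrable u -> cintegrable v ->
    cintegrable (fun y => u y + v y).
  move=> [mu uoo] [mv voo]; apply: (cintegrable_le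
     (h := fun y => nC (u y) + nC (v y))).
  - exact: cmfunD.
  - by apply: measurable_funD; exact: measurable_normc.
  - by move=> y; exact: le_normcD.
  - under eq_integral do rewrite EFinD.
    rewrite ge0_integralD//; first by rewrite lte_add_pinfty.
    + by move=> y _; rewrite lee_fin normc_ge0.
    + exact: measurable_enormc.
    + by move=> y _; rewrite lee_fin normc_ge0.
    + exact: measurable_enormc.
rewrite -cintegralD; [|exact: ci|exact: ci].
rewrite -cintegralD; [|by apply: cD; exact: ci|exact: ci].
apply: eq_cintegral => xi; rewrite !product_weightE addr0.
rewrite [in LHS](lp_partition j xi L0 L) -!mulrDl -!rmorphD; congr (_ * _ * _).
by congr (_%:C)%C; rewrite !mulrDl.
Qed.

(** If one maximal function vanishes, the bound in b) is 0 even when the other is infinite, a case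
    which the estimate for finite maximal functions misses. Either bound on the pieces then already
    makes each of them 0. *)
Lemma is_frac_int_zero psi (p : R) f fhat x : littlewood_paley psi -> 1 <= p ->
  in_Lp p%:E f -> fourier_Lp p%:E f fhat ->
  HL_maximal_rV fhat 0 = 0%E \/ HL_maximal_rV f x = 0%E ->
  is_frac_int psi alpha fhat x 0.
Proof.
move=> L p1 fp fhatp H0; have [A A0 hA] := dyadic_weight_bounds (lp_amplitude L).
rewrite /is_frac_int (_ : frac_int_piece _ _ _ _ = fun _ => 0); first exact: is_sumZ0.
apply/funext => j; rewrite frac_int_pieceE.
apply: ComplexField.Normc.eq0_normc; apply/eqP.
have [h1 h2] := hA p f fhat x j p1 fp fhatp.
rewrite eq_le normc_ge0 andbT -lee_fin.
by case: H0 => H0; [move: h2|move: h1]; rewrite H0 mule0.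
Qed.

Hypothesis beta_gt0 : 0 < beta.

(* Both sums equal that of the pieces cut off by psi_j psi0_k with
   |j - k| <= 1. *)
Lemma is_frac_int_indep psi psi0 (p : R) f fhat x :
  littlewood_paley psi -> littlewood_paley psi0 -> 1 <= p ->
  in_Lp p%:E f -> fourier_Lp p%:E f fhat ->
  (HL_maximal_rV fhat 0 < +oo)%E -> (HL_maximal_rV f x < +oo)%E ->
  exists2 s, is_frac_int psi alpha fhat x s & is_frac_int psi0 alpha fhat x s.
Proof.
move=> L L0 p1 fp fhatp hoo foo.
have mfh : cmfun fhat by exact: cmfun_fourier_Lp fhatp.
have hfin : HL_maximal_rV fhat 0 \is a fin_num.
  by rewrite ge0_fin_numE ?HL_maximal_rV_ge0.
have ffin : HL_maximal_rV f x \is a fin_num.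
  by rewrite ge0_fin_numE ?HL_maximal_rV_ge0.
pose c (d j : int) :=
  weighted_inverse (dyadic_weight (product_profile psi psi0 d) j) fhat x.
have sc d : exists s, is_sumZ (c d) s.
  have [A A0 hA] := dyadic_weight_bounds (product_amplitude d L L0).
  apply: (is_sumZ_dyadic (a := c d) (A := A) (mf := fine (HL_maximal_rV f x))
    (mh := fine (HL_maximal_rV fhat 0)) alpha_gt0 beta_gt0) => //.
  - by apply: fine_ge0; exact: HL_maximal_rV_ge0.
  - move=> j; have [h1 _] := hA p f fhat x j p1 fp fhatp.
    by rewrite -lee_fin EFinM fineK.
  - move=> j; have [_ h2] := hA p f fhat x j p1 fp fhatp.
    by rewrite -lee_fin EFinM fineK.
have sw (u v w : R[i]) : u + v + w = w + v + u.
  by rewrite addrC [u + v]addrC addrA.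
have [s1 h1] := sc (- 1); have [s2 h2] := sc 0; have [s3 h3] := sc 1.
exists (s1 + s2 + s3).
  rewrite /is_frac_int (_ : frac_int_piece _ _ _ _ =
    fun j => c (- 1) j + c 0 j + c 1 j); last first.
    by apply/funext => j; exact: frac_int_piece_partition.
  by apply: is_sumZD => //; exact: is_sumZD.
(* The pieces of [psi0] are the same three families, each reindexed through [product_weightC]; the
   sum over the integers is invariant under these shifts. *)
rewrite /is_frac_int (_ : frac_int_piece _ _ _ _ =
  fun j => c (- 1) (j + 1) + c 0 (j + 0) + c 1 (j + - 1)); last first.
  apply/funext => j; rewrite (frac_int_piece_partition x j L0 L mfh hoo) /c.
  rewrite !(product_weightC psi psi0) opprK oppr0 addrK !addr0 subrK.
  exact: sw.
by apply: is_sumZD; [apply: is_sumZD|]; exact: is_sumZ_shift.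
Qed.

(** [K] depends on [psi0] alone: the bound is proved for the pieces of [psi0] and transferred to
    [psi] by equality of the sums. One [s] serves every [lambda], which permits optimizing over
    [lambda] afterwards. *)
Lemma frac_int_estimate psi0 : littlewood_paley psi0 ->
  exists2 K, 0 <= K & forall psi (p : R) f fhat x, littlewood_paley psi ->
  1 <= p -> in_Lp p%:E f -> fourier_Lp p%:E f fhat ->
  (HL_maximal_rV fhat 0 < +oo)%E -> (HL_maximal_rV f x < +oo)%E ->
  exists2 s, is_frac_int psi alpha fhat x s & forall lambda : R, 0 < lambda ->
    nC s <= K * (lambda `^ beta * fine (HL_maximal_rV fhat 0) +
                 lambda `^ (- alpha) * fine (HL_maximal_rV f x)).
Proof.
move=> L0; have [A A0 hA] := dyadic_weight_bounds (lp_amplitude L0).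
exists (A * lp_constant alpha beta) => [|psi p f fhat x L p1 fp fhatp hoo foo].
  rewrite mulr_ge0// /lp_constant addr_ge0 ?divr_ge0 ?invr_ge0 ?powR_ge0//.
    by have /andP[_ /ltW] := powR2N_lt1 alpha_gt0; rewrite subr_ge0.
  by have /andP[_ /ltW] := powR2N_lt1 beta_gt0; rewrite subr_ge0.
have [s sp sp0] := is_frac_int_indep L L0 p1 fp fhatp hoo foo.
exists s => // lambda l0.
have h0 := HL_maximal_rV_ge0 fhat 0; have f0 := HL_maximal_rV_ge0 f x.
apply: (normc_is_sumZ_dyadic_le alpha_gt0 beta_gt0 A0 _ _ _ _ l0 sp0).
- exact: fine_ge0.
- exact: fine_ge0.
- move=> j; have [h1 _] := hA p f fhat x j p1 fp fhatp.
  by rewrite frac_int_pieceE -lee_fin EFinM fineK// ge0_fin_numE.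
- move=> j; have [_ h2] := hA p f fhat x j p1 fp fhatp.
  by rewrite frac_int_pieceE -lee_fin EFinM fineK// ge0_fin_numE.
Qed.

End fractional_integral.

(** [(Y / X) ^ (1 / nn)] is the solution [lambda] of [lambda ^ (nn - alpha) X = lambda ^ (- alpha)
    Y], with [X] and [Y] standing for the maximal functions of the transform and of the function. *)
Lemma powR_balance (R : realType) (X Y nn alpha : R) :
  0 < X -> 0 < Y -> 0 < nn ->
  ((Y / X) `^ nn^-1) `^ (nn - alpha) * X =
    X `^ (alpha / nn) * Y `^ (1 - alpha / nn) /\
  ((Y / X) `^ nn^-1) `^ (- alpha) * Y = X `^ (alpha / nn) * Y `^ (1 - alpha / nn).
Proof.
move=> X0 Y0 n0; have YX : 0 < Y / X by exact: divr_gt0.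
have e (r : R) : (Y / X) `^ r = Y `^ r * X `^ (- r).
  rewrite powRM ?invr_ge0 ?(ltW X0) ?(ltW Y0)//; congr (_ * _).
  by rewrite -[in LHS]powR_inv1 ?(ltW X0)// -powRrM mulN1r.
have X1 : X = X `^ 1 by rewrite powRr1// ltW.
have Y1 : Y = Y `^ 1 by rewrite powRr1// ltW.
have nX (r : R) : (r == 0) ==> (X != 0) by rewrite (gt_eqF X0) implybT.
have nY (r : R) : (r == 0) ==> (Y != 0) by rewrite (gt_eqF Y0) implybT.
have -> : 1 - alpha / nn = nn^-1 * (nn - alpha) by field; rewrite gt_eqF.
split; rewrite -powRrM e.
  rewrite [Z in _ * Z]X1 -mulrA -powRD// mulrC; congr (X `^ _ * _).
  by field; rewrite gt_eqF.
rewrite mulrAC [Z in _ * Z * _]Y1 -powRD// mulrC.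
have -> : nn^-1 * - alpha + 1 = nn^-1 * (nn - alpha) by field; rewrite gt_eqF.
by congr (X `^ _ * _); field; rewrite gt_eqF.
Qed.

Theorem theorem2p1 (R : realType) (n : nat) (alpha : R) :
  0 < alpha < n%:R ->
  exists c : R,
    forall psi : 'rV[R]_n -> R, littlewood_paley psi ->
    forall (p : R) (f fhat : 'rV[R]_n -> R[i]), 1 <= p <= 2 ->
    in_Lp p%:E f -> fourier_Lp p%:E f fhat ->
    forall x : 'rV[R]_n,
      (forall lambda : R, 0 < lambda ->
        let bound := (c%:E *
          ((lambda `^ (n%:R - alpha))%:E * HL_maximal_rV fhat 0%R +
           (lambda `^ (- alpha))%:E * HL_maximal_rV f x))%E in
        (bound < +oo)%E ->
        exists2 s : R[i], is_frac_int psi alpha fhat x s &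
          ((ComplexField.Normc.normc s)%:E <= bound)%E) /\
      (let bound := (c%:E *
          (HL_maximal_rV fhat 0%R `^ (alpha / n%:R) *
           HL_maximal_rV f x `^ (1 - alpha / n%:R)))%E in
        (bound < +oo)%E ->
        exists2 s : R[i], is_frac_int psi alpha fhat x s &
          ((ComplexField.Normc.normc s)%:E <= bound)%E).
Proof.
move=> /andP[alpha0 alphan].
have beta0 : 0 < n%:R - alpha by rewrite subr_gt0.
have [[psi0 L0]|noL] := pselect (exists psi0 : 'rV[R]_n -> R, littlewood_paley psi0);
  last by exists 0 => psi L; exfalso; apply: noL; exists psi.
have [K K0 est] := frac_int_estimate alpha0 beta0 L0.
(* The factor 2 is for b), where two equal terms are added. Strict positivity matters since [K] may
   be 0: a zero constant would make the bound finite even for an infinite maximal function. *)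
have [c [c0 Kc]] : exists c : R, 0 < c /\ 2 * K <= c.
  by exists (2 * K + 1); rewrite lerDl ltr_wpDl// mulr_ge0.
have Kc1 : K <= c by lra.
exists c => psi L p f fhat /andP[p1 _] fp fhatp x.
set mh := HL_maximal_rV fhat 0; set mf := HL_maximal_rV f x.
have h0 : (0 <= mh)%E by exact: HL_maximal_rV_ge0.
have f0 : (0 <= mf)%E by exact: HL_maximal_rV_ge0.
split=> [lambda l0|] bound boundoo.
  have lb : 0 < lambda `^ (n%:R - alpha) by exact: powR_gt0.
  have la : 0 < lambda `^ (- alpha) by exact: powR_gt0.
  have hoo : (mh < +oo)%E.
    rewrite ltey; apply: contraTneq boundoo => h.
    rewrite /bound h gt0_muley ?lte_fin// addye ?gt0_muley ?ltxx ?lte_fin//.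
    by rewrite -ltNye (lt_le_trans ltNy0)// mule_ge0// lee_fin ltW.
  have foo : (mf < +oo)%E.
    rewrite ltey; apply: contraTneq boundoo => h.
    rewrite /bound h [((lambda `^ (- alpha))%:E * _)%E]gt0_muley ?lte_fin//.
    rewrite addey ?gt0_muley ?ltxx ?lte_fin//.
    by rewrite -ltNye (lt_le_trans ltNy0)// mule_ge0// lee_fin ltW.
  have [s sp sb] := est psi p f fhat x L p1 fp fhatp hoo foo.
  exists s => //; rewrite /bound.
  have [[u uE] [v vE]] : (exists u, mh = u%:E) /\ (exists v, mf = v%:E).
    by split; [exists (fine mh)|exists (fine mf)]; rewrite fineK// ge0_fin_numE.
  have {sb} := sb _ l0; rewrite -/mh -/mf uE vE /= => sb.
  rewrite -[leRHS]/((c * (lambda `^ (n%:R - alpha) * u +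
    lambda `^ (- alpha) * v))%:E) lee_fin; apply: (le_trans sb).
  move: h0 f0; rewrite uE vE !lee_fin => u0 v0.
  by rewrite ler_wpM2r// addr_ge0// mulr_ge0// ltW.
have bound0 : (0 <= bound)%E.
  by rewrite mule_ge0 ?lee_fin ?(ltW c0)// mule_ge0// poweR_ge0.
have n0 : 0 < n%:R :> R by exact: lt_trans alphan.
have [mz|mnz] := boolP ((mh == 0%E) || (mf == 0%E)).
  exists 0; last by rewrite ComplexField.Normc.normc0.
  apply: (is_frac_int_zero alpha0 L p1 fp fhatp).
  by case/orP : mz => /eqP; [left|right].
move: mnz; rewrite negb_or => /andP[mhn mfn].
have hp : (0 < mh)%E by rewrite lt_neqAle eq_sym mhn.
have fp0 : (0 < mf)%E by rewrite lt_neqAle eq_sym mfn.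
have an0 : alpha / n%:R != 0 by rewrite gt_eqF// divr_gt0.
have an1 : 1 - alpha / n%:R != 0 by rewrite gt_eqF// subr_gt0 ltr_pdivrMr// mul1r.
(* Both exponents are nonzero and the other factor is positive, so an infinite maximal function
   would make the bound infinite. *)
have hoo : (mh < +oo)%E.
  rewrite ltey; apply: contraTneq boundoo => h.
  by rewrite /bound h poweRyr// gt0_mulye ?poweR_gt0// gt0_muley ?ltxx ?lte_fin.
have foo : (mf < +oo)%E.
  rewrite ltey; apply: contraTneq boundoo => h.
  by rewrite /bound h poweRyr// gt0_muley ?poweR_gt0// gt0_muley ?ltxx ?lte_fin.
have [s sp sb] := est psi p f fhat x L p1 fp fhatp hoo foo.
exists s => //; rewrite /bound.
have hE : (fine mh)%:E = mh by rewrite fineK// ge0_fin_numE.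
have fE : (fine mf)%:E = mf by rewrite fineK// ge0_fin_numE.
have X0 : 0 < fine mh by rewrite -lte_fin hE.
have Y0 : 0 < fine mf by rewrite -lte_fin fE.
rewrite -hE -fE !poweR_EFin -!EFinM lee_fin.
have [e1 e2] := powR_balance alpha X0 Y0 n0.
(* At this balancing value of [lambda] both terms equal the product in b), and their sum is absorbed
   by [2 * K <= c]. *)
have l0 : 0 < (fine mf / fine mh) `^ n%:R^-1 by rewrite powR_gt0// divr_gt0.
apply: (le_trans (sb _ l0)); rewrite -/mh -/mf e1 e2.
set Z := _ `^ _ * _ `^ _; have Z0 : 0 <= Z by rewrite mulr_ge0// powR_ge0.
by rewrite -mulr2n -[Z *+ 2]mulr_natl mulrA ler_wpM2r// mulrC.
Qed.
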